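(* Let $X$ be a complex manifold of dimension $n=2$, $U\subset X$ a domain, and $\rho:U\to\mathbb{R}$ a smooth, strictly plurisubharmonic Morse function. Let $t_0\in\mathbb{R}$ be such that the level set $\Sigma_{t_0}=\{x\in U:\rho(x)=t_0\}$ is connected and compact and contains exactly one critical point $c$ of $\rho$, with Morse index $\mathrm{ind}\,\rho|_{c}=2$. Let $\mathcal{N}$ be a holomorphic line bundle on $U$ and let $\mathcal{F}$ be a $k$-th root ($k\ge2$) of $\mathcal{N}$ on $U_{t_0}^{+}=\{x\in U:\rho(x)>t_0\}$. If $\mathcal{F}$ does not extend (as a holomorphic line bundle) to a neighborhood of $c$, then there exists a neighborhood $V$ of $c$ biholomorphic to $K^2$ such that, after identifying $V$ with $K^2$, the bundle $\mathcal{F}|_{K^2\cap U_{t_0}^{+}}$ extends to $D$ and is isomorphic there to $\mathcal{F}_k(l)$ for some $1\le l<k$.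
   Context: A $k$-th root of a holomorphic line bundle $\mathcal{N}$ on an open set $G$ is a holomorphic line bundle $\mathcal{F}$ on $G$ with $\mathcal{F}^{\otimes k}\cong\mathcal{N}|_{G}$. A bundle $\mathcal{F}$ on $Y$ extends to $\widetilde Y\supset Y$ if there is a holomorphic bundle on $\widetilde Y$ whose restriction to $Y$ is isomorphic to $\mathcal{F}$; ''$\mathcal{F}$ extends to a neighborhood of $c$'' means that it extends to $U_{t_0}^{+}\cup B$ for some open neighborhood $B$ of $c$. Write $z_j=x_j+iy_j$, $j=1,2$, for the coordinates of $\mathbb{C}^2$. Set $K^2=\{z\in\mathbb{C}^2: |x_j|<1, |y_j|<1,\ j=1,2\}$ and $D=K^2\setminus\{x_1=x_2=0\}$. Let $C=\{y_1=y_2=0,\ x_1^2+x_2^2=1/2\}$ be the generator of $H_1(D,\mathbb{Z})$, let $A\in H^1(D,\mathbb{Z})$ be the class with $\langle A,C\rangle=1$, let $\mathrm{j}:H^1(D,\mathbb{Z})\to H^1(D,\mathcal{O})$ be the natural imbedding and $B=\mathrm{j}(A)$. For $k\ge2$ and $1\le l<k$, $\mathcal{F}_k(l)$ denotes the holomorphic line bundle on $D$ corresponding to the class $\exp\left(\frac{l}{k}B\right)\in H^1(D,\mathcal{O}^* )$, where $\exp:H^1(D,\mathcal{O})\to H^1(D,\mathcal{O}^* )$ is induced by $f\mapsto e^{2\pi i f}$. *)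

(* Defs.v *)
From HB Require Import structures.
From mathcomp Require Import all_boot all_order all_algebra.
From mathcomp Require Import complex.
From mathcomp Require Import all_classical all_reals all_analysis.
Set Implicit Arguments.
Unset Strict Implicit.
Unset Printing Implicit Defensive.
Import Order.TTheory GRing.Theory Num.Theory numFieldNormedType.Exports.
Local Open Scope classical_set_scope.
Local Open Scope ring_scope.

(* The usual topology and normed space structure of the field [R[i]]. *)
#[non_forgetful_inheritance]
HB.instance Definition _ (R : realType) :=
  PseudoPointedMetric.copy R[i] R[i]^o.
#[non_forgetful_inheritance]
HB.instance Definition _ (R : realType) := NormedModule.copy R[i] R[i]^o.

Section Charts.
Context {R : realType} {n : nat} {X : topologicalType}.

(* [cmap] is only meaningful on [cdom], and [cinv] on [ccodom]. *)
Record chart := Chart {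
  cdom : set X ;
  cmap : X -> 'rV[R[i]]_n ;
  cinv : 'rV[R[i]]_n -> X }.

Definition ccodom (phi : chart) : set 'rV[R[i]]_n := cmap phi @` cdom phi.

Definition is_chart (phi : chart) : Prop :=
  [/\ open (cdom phi), open (ccodom phi),
      {in cdom phi, continuous (cmap phi)},
      {in ccodom phi, continuous (cinv phi)} &
      {in cdom phi, cancel (cmap phi) (cinv phi)}].

(* [differentiable] is over the field [R[i]], i.e. complex differentiable. *)
Definition holomorphic_transition (phi psi : chart) : Prop :=
  forall x, cdom phi x -> cdom psi x ->
    differentiable (cmap psi \o cinv phi : 'rV[R[i]]_n -> 'rV[R[i]]_n)
      (cmap phi x).

Definition is_atlas (A : set chart) : Prop :=
  [/\ forall phi, A phi -> is_chart phi,
      forall phi psi, A phi -> A psi -> holomorphic_transition phi psi &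
      forall x, exists2 phi, A phi & cdom phi x].

Definition complex_manifold (A : set chart) : Prop :=
  [/\ hausdorff_space X, @second_countable X & is_atlas A].

(* A biholomorphism of the open set [cdom phi] onto the open set [ccodom phi]
   of C^n. *)
Definition is_biholomorphism (A : set chart) (phi : chart) : Prop :=
  is_chart phi /\
  forall psi, A psi ->
    holomorphic_transition phi psi /\ holomorphic_transition psi phi.

Definition holomorphic (A : set chart) (W : set X) (f : X -> R[i]) : Prop :=
  forall phi x, A phi -> W x -> cdom phi x ->
    differentiable (f \o cinv phi : 'rV[R[i]]_n -> R[i]^o) (cmap phi x).

Definition level_set (U : set X) (rho : X -> R) (t : R) : set X :=
  [set x | U x /\ rho x = t].

Definition superlevel_set (U : set X) (rho : X -> R) (t : R) : set X :=
  [set x | U x /\ t < rho x].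

Definition domain (U : set X) : Prop :=
  [/\ open U, connected U & U !=set0].

End Charts.
Arguments chart : clear implicits.

Definition std_atlas (R : realType) (n : nat) :
    set (chart R n 'rV[R[i]]_n) :=
  [set Chart setT id id].
Arguments std_atlas : clear implicits.

Section RealCalculus.
Context {R : realType}.

(* For [W] open. *)
Fixpoint Ck (m : nat) {N : nat} (W : set 'rV[R]_N) (f : 'rV[R]_N -> R^o) :
    Prop :=
  if m is m'.+1 then
    (forall v, W v -> differentiable f v) /\ (forall u, Ck m' W ('D_u f))
  else {in W, continuous f}.

Definition partial {N : nat} (a : 'I_N) (f : 'rV[R]_N -> R^o) :
    'rV[R]_N -> R^o :=
  'D_(delta_mx 0 a) f.

Definition hessian {N : nat} (f : 'rV[R]_N -> R^o) (v : 'rV[R]_N) : 'M[R]_N :=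
  \matrix_(a, b) partial a (partial b f) v.

Definition negative_definite_on {N : nat} (H W : 'M[R]_N) : Prop :=
  forall v : 'rV[R]_N, (v <= W)%MS -> v != 0 -> (v *m H *m v^T) 0 0 < 0.

(* [m] is the maximal dimension of a subspace (the row space of some [W]) on
   which the quadratic form of [H] is negative definite. *)
Definition negative_index {N : nat} (H : 'M[R]_N) (m : nat) : Prop :=
  (exists2 W : 'M[R]_N, \rank W = m & negative_definite_on H W) /\
  (forall W : 'M[R]_N, negative_definite_on H W -> (\rank W <= m)%N).

(* Real coordinates (x_1, .., x_n, y_1, .., y_n) of C^n, z_j = x_j + i y_j. *)
Definition of_real {n : nat} (v : 'rV[R]_(n + n)) : 'rV[R[i]]_n :=
  \row_j Complex (v 0 (lshift n j)) (v 0 (rshift n j)).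

Definition to_real {n : nat} (z : 'rV[R[i]]_n) : 'rV[R]_(n + n) :=
  row_mx (\row_j complex.Re (z 0 j)) (\row_j complex.Im (z 0 j)).

(* The entries are d^2 f / dz_j d\bar z_k in terms of the real Hessian, where
   d/dz_j = (d/dx_j - i d/dy_j) / 2 and d/d\bar z_k = (d/dx_k + i d/dy_k) / 2. *)
Definition levi_matrix {n : nat} (H : 'M[R]_(n + n)) : 'M[R[i]]_n :=
  \matrix_(j, k)
    (4%:R^-1 *
     Complex (H (lshift n j) (lshift n k) + H (rshift n j) (rshift n k))
             (H (lshift n j) (rshift n k) - H (rshift n j) (lshift n k))).

Definition positive_definite_form {n : nat} (L : 'M[R[i]]_n) : Prop :=
  forall w : 'rV[R[i]]_n, w != 0 ->
    0 < \sum_j \sum_k L j k * w 0 j * (w 0 k)^*.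

End RealCalculus.

Section RealFunctions.
Context {R : realType} {n : nat} {X : topologicalType}.
Variables (A : set (chart R n X)) (U : set X) (rho : X -> R).

Definition in_chart (phi : chart R n X) : 'rV[R]_(n + n) -> R^o :=
  rho \o cinv phi \o of_real.

Definition real_coord (phi : chart R n X) (x : X) : 'rV[R]_(n + n) :=
  to_real (cmap phi x).

Definition hessian_at (phi : chart R n X) (x : X) : 'M[R]_(n + n) :=
  hessian (in_chart phi) (real_coord phi x).

Definition smooth : Prop :=
  forall phi m, A phi ->
    Ck m (real_coord phi @` (cdom phi `&` U)) (in_chart phi).

Definition strictly_plurisubharmonic : Prop :=
  forall phi x, A phi -> U x -> cdom phi x ->
    positive_definite_form (levi_matrix (hessian_at phi x)).

Definition critical_point (x : X) : Prop :=
  forall phi, A phi -> cdom phi x ->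
    forall u, 'D_u (in_chart phi) (real_coord phi x) = 0.

Definition morse : Prop :=
  forall x, U x -> critical_point x ->
    forall phi, A phi -> cdom phi x -> \det (hessian_at phi x) != 0.

Definition morse_index_is (c : X) (m : nat) : Prop :=
  forall phi, A phi -> cdom phi c -> negative_index (hessian_at phi c) m.

End RealFunctions.

(* A Cech 1-cochain over an indexed family of sets.  The functions
   [cval i j] are only meaningful on [ccover i `&` ccover j]. *)
Record cech1 (T G : Type) := Cech1 {
  cix : Type ;
  ccover : cix -> set T ;
  cval : cix -> cix -> T -> G }.
Arguments ccover {T G} c _ _.
Arguments cval {T G} c _ _ _.

Section Cech.
Context {T : topologicalType}.

(* A cocycle over an open cover of [W], for the sheaf whose sections over an
   open set [V] are the functions satisfying [sec V], with group law [op]. *)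
Definition is_cocycle {G : Type} (op : G -> G -> G)
    (sec : set T -> (T -> G) -> Prop) (W : set T) (a : cech1 T G) : Prop :=
  [/\ forall i, open (ccover a i),
      \bigcup_i ccover a i = W,
      forall i j, sec (ccover a i `&` ccover a j) (cval a i j) &
      forall i j k x, ccover a i x -> ccover a j x -> ccover a k x ->
        op (cval a i j x) (cval a j k x) = cval a i k x].

Definition locally_constant (W : set T) (f : T -> int) : Prop :=
  forall x, W x -> \forall y \near x, f y = f x.

(* The cocycles representing the classes of H^1(W, Z). *)
Definition Z_cocycle : set T -> cech1 T int -> Prop :=
  is_cocycle (fun a b => a + b) locally_constant.

(* [m] is the value of the class of [a] on the loop [gamma]: [0, 1] is subdivided
   so that [gamma] maps each [t s, t s.+1] into a member [idx s] of the cover,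
   and the transition values met along the loop are added up. *)
Definition loop_pairing {R : realType} (a : cech1 T int) (gamma : R -> T)
    (m : int) : Prop :=
  exists (N : nat) (t : nat -> R) (idx : nat -> cix a),
    [/\ t 0%N = 0, t N = 1, idx N = idx 0%N,
        forall s, (s < N)%N -> t s <= t s.+1 /\
          forall u, t s <= u <= t s.+1 -> ccover a (idx s) (gamma u) &
        m = \sum_(s < N) cval a (idx s) (idx s.+1) (gamma (t s.+1))].

End Cech.

Definition cech_map {T G G' : Type} (h : G -> G') (a : cech1 T G) :
    cech1 T G' :=
  Cech1 (ccover a) (fun i j x => h (cval a i j x)).

(* The restriction to [W] of the pullback by [f]. *)
Definition cech_pullback {S T G : Type} (f : S -> T) (W : set S)
    (a : cech1 T G) : cech1 S G :=
  Cech1 (fun i => W `&` f @^-1` ccover a i) (fun i j x => cval a i j (f x)).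

Definition cech_restrict {T G : Type} (W : set T) (a : cech1 T G) :
    cech1 T G :=
  cech_pullback id W a.

Section LineBundles.
Context {R : realType} {n : nat} {X : topologicalType}.
Variable A : set (chart R n X).

Definition holomorphic_unit (W : set X) (f : X -> R[i]) : Prop :=
  holomorphic A W f /\ forall x, W x -> f x != 0.

(* A holomorphic line bundle on [W] is given by its transition functions
   g_ij with respect to a trivializing open cover; a section is a family of
   functions with s_i = g_ij s_j. *)
Definition line_bundle (W : set X) (L : cech1 X R[i]) : Prop :=
  is_cocycle (fun a b => a * b) holomorphic_unit W L.

(* An isomorphism maps the section (s_i) of [L] to the section (t_p) of [M]
   with t_p = h_ip s_i. *)
Definition bundle_iso (L M : cech1 X R[i]) : Prop :=
  exists h : cix L -> cix M -> X -> R[i],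
    (forall i p, holomorphic_unit (ccover L i `&` ccover M p) (h i p)) /\
    (forall i j p q x, ccover L i x -> ccover L j x ->
      ccover M p x -> ccover M q x ->
      h i p x * cval L i j x = cval M p q x * h j q x).

Definition tensor_power (k : nat) (L : cech1 X R[i]) : cech1 X R[i] :=
  cech_map (fun g => g ^+ k) L.

Definition is_root (k : nat) (N : cech1 X R[i]) (W : set X)
    (F : cech1 X R[i]) : Prop :=
  line_bundle W F /\ bundle_iso (tensor_power k F) (cech_restrict W N).

Definition is_extension (Y Y' : set X) (F E : cech1 X R[i]) : Prop :=
  [/\ Y `<=` Y', line_bundle Y' E & bundle_iso (cech_restrict Y E) F].

Definition extends_near (Y : set X) (c : X) (F : cech1 X R[i]) : Prop :=
  exists (B : set X) (E : cech1 X R[i]),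
    [/\ open B, B c & is_extension Y (Y `|` B) F E].

End LineBundles.

Section Model.
Context {R : realType}.

Definition cexp (z : R[i]) : R[i] :=
  Complex (expR (complex.Re z) * cos (complex.Im z))
          (expR (complex.Re z) * sin (complex.Im z)).

Definition K2 : set 'rV[R[i]]_2 :=
  [set z | forall j, `|complex.Re (z 0 j)| < 1 /\ `|complex.Im (z 0 j)| < 1].

Definition D2 : set 'rV[R[i]]_2 :=
  K2 `\` [set z | forall j, complex.Re (z 0 j) = 0].

(* The circle y_1 = y_2 = 0, x_1^2 + x_2^2 = 1/2, traversed once, counter-
   clockwise in the (x_1, x_2)-plane, for t in [0, 1]. *)
Definition circleC (t : R) : 'rV[R[i]]_2 :=
  \row_j Complex
    ((if j == 0 then cos (2 * pi * t) else sin (2 * pi * t)) / Num.sqrt 2) 0.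

Definition is_generator (a : cech1 'rV[R[i]]_2 int) : Prop :=
  Z_cocycle D2 a /\ loop_pairing a circleC 1.

Definition j_map {T : Type} (a : cech1 T int) : cech1 T R[i] :=
  cech_map (fun m => m%:~R) a.

Definition exp_map {T : Type} (b : cech1 T R[i]) : cech1 T R[i] :=
  cech_map (fun f => cexp (Complex 0 (2 * pi) * f)) b.

(* The bundle with class exp((l/k) j([a])). *)
Definition F_bundle (k l : nat) (a : cech1 'rV[R[i]]_2 int) :
    cech1 'rV[R[i]]_2 R[i] :=
  exp_map (cech_map (fun f => l%:R / k%:R * f) (j_map a)).

End Model.

(* Main.v *)
Require Import Defs.
From HB Require Import structures.
From mathcomp Require Import all_boot all_order all_algebra.
From mathcomp Require Import complex ring lra.
From mathcomp Require Import all_classical all_reals all_analysis.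
Import Order.TTheory GRing.Theory Num.Theory numFieldNormedType.Exports.
Local Open Scope classical_set_scope.
Local Open Scope ring_scope.
Set Implicit Arguments.
Unset Strict Implicit.
Unset Printing Implicit Defensive.

(** Near the critical point the superlevel set has the homotopy type of a circle,
and a line bundle whose [k]-th power is trivial is a flat bundle whose
monodromy around that circle is a [k]-th root of unity; the bundles [F_bundle]
realize all these monodromies.

Coordinates.  The Hessian of [rho] at [c] is negative definite on some real
plane [W].  Four times the Levi form at a vector [v] is the sum of the values
of the Hessian at [v] and at [i v]; as it is positive, the Hessian is positive
definite on [i W], so [W] contains no complex line and vectors of [i W] form
a complex basis of C^2 ([negative_plane], [frame_unit]).  In the coordinates
[z = x + i y] of that basis the box |x_j|, |y_j| < 1, once scaled down, carries
a function [rho] that is strictly convex along real directions and strictly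
concave along imaginary ones.  Hence [rho > t0] at the real points other than
the origin, [rho <= t0] where [x = 0], and for fixed [x] the set [rho > t0] is
star-shaped in [y] ([box_real_gt], [box_imag_le], [box_imag_segment]).  So the
superlevel set [Y] in the box is contained in [D2] and shrinks onto a punctured
real square; the record [thickening] keeps only these facts.

Flatness.  The box is chosen inside a set that trivializes [N], which gives
units [h i] with [h i * g_ij ^+ k = h j].  Rescaling the local frames by local
[k]-th roots of [1 / h i] turns the transition functions into [k]-th roots of
unity, that is, into a locally constant cocycle with values in Z/k.

Topology.  A locally constant cocycle is trivial on the part of [Y] over a
star-shaped slit square, by homotopy lifting ([flat_section_homotopy]).
The right and the left slit squares meet in two half squares.  Sections over
the two can be made to agree on the upper one, and then they differ by a
constant on the lower one, the monodromy.  For the generator [a] it is [-1],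
because the sum that defines the loop pairing telescopes ([loop_monodromy]).
So a cocycle with monodromy [m] minus [- m] times [a] is trivial
([multiple_of_generator]), and exponentiating this triviality gives the
isomorphism with [F_bundle k l a] ([torsion_bundle_iso]).

Finally [l] is not [0]: otherwise the bundle would be trivial on [Y] and would
glue with the trivial bundle of the box to an extension across [c]
([trivial_extends]). *)

(** * Locally constant functions and flat sections of locally constant cocycles *)

Definition locconst {T : topologicalType} {G : Type} (S : set T) (f : T -> G) :=
  forall x, S x -> \forall y \near x, f y = f x.

Lemma locconst_cst {T : topologicalType} {G : Type} (S : set T) (g : G) :
  locconst S (fun=> g).
Proof. by move=> x _; exact: nearW. Qed.

(** Otherwise the supremum of the points where [P] holds could be passed. *)
Lemma real_induction (R : realType) (P : R -> Prop) (a b : R) :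
  P a -> (forall t u, t <= u -> P u -> P t) ->
  (forall t, a <= t <= b ->
     exists2 e, 0 < e & forall u, t - e < u -> P u -> P (t + e)) ->
  P b.
Proof.
move=> Pa mono step; apply: contrapT => nPb.
have ltb t : P t -> t < b by move=> Pt; rewrite ltNge; apply/negP => /mono /(_ Pt).
have hs : has_sup [set t | P t].
  by split; [exists a | exists b => t /ltb /ltW].
have as_ : a <= sup [set t | P t] by apply: ub_le_sup => //; case: hs.
have sb : sup [set t | P t] <= b.
  by apply: ge_sup; [case: hs | move=> t /ltb /ltW].
have [|e e0 he] := step (sup [set t | P t]); first by rewrite as_ sb.
have [u Pu us] := sup_adherent e0 hs.
have := ub_le_sup (let: conj _ h := hs in h) (he _ us Pu).
by rewrite leNgt ltrDl e0.
Qed.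

Lemma locconst_segment (R : realType) (G : Type) (f : R -> G) (a b : R) :
  a <= b -> locconst [set t | a <= t <= b] f -> f a = f b.
Proof.
move=> ab fl.
pose P u := forall t, a <= t <= b -> t <= u -> f t = f a.
suff : P b by move=> /(_ b); rewrite ab lexx => /(_ isT isT) ->.
apply: (@real_induction _ P a).
- move=> t /andP[ta _] at_; congr f; apply/le_anti; by rewrite at_ ta.
- by move=> t u tu Pu v hv vt; apply: Pu => //; apply: le_trans tu.
move=> t abt; have /nbhs_ballP[e /= e0 he] := fl t abt.
exists (e / 2); first by rewrite divr_gt0.
have he' v : `|t - v| < e -> f v = f t by move=> h; apply: he.
move=> u hu Pu v hv vt.
have ta : f t = f a.
  have [tu|ut] := leP t u; first exact: Pu.
  have [au|ua] := leP a u.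
    rewrite -(Pu u) ?lexx ?au//=; last by move: abt => /andP[_]; lra.
    apply/esym/he'; rewrite ger0_norm; lra.
  apply/esym/he'; rewrite ger0_norm; first by move: hv abt => /andP[? ?]/andP[? ?]; lra.
  by move: abt => /andP[]; lra.
have [vu|uv] := leP v u; first exact: Pu.
rewrite -ta; apply: he'; have [?|?] := leP t v; [rewrite ler0_norm|rewrite ger0_norm]; lra.
Qed.

Lemma continuous_pair (P T U : topologicalType) (f : P -> T) (g : P -> U) x :
  {for x, continuous f} -> {for x, continuous g} ->
  {for x, continuous (fun y => (f y, g y))}.
Proof. by move=> fc gc; exact: (cvg_pair fc gc). Qed.

Section FlatSections.
Context {T : topologicalType} {G : zmodType}.

(** Such a cocycle is a principal bundle over [W] whose structure group is the
discrete group [G]. *)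
Definition local_system (W : set T) (c : cech1 T G) :=
  is_cocycle (fun a b => a + b) (@locconst T G) W c.

(** A flat section over [S] of the pullback by [f] of the principal bundle of [c];
[s i] is its coordinate in the [i]-th trivialization and is meaningless where
[f] leaves [ccover c i]. *)
Definition flat_section {P : topologicalType} (c : cech1 T G) (S : set P)
    (f : P -> T) (s : cix c -> P -> G) : Prop :=
  (forall i z, S z -> ccover c i (f z) -> \forall w \near z, s i w = s i z) /\
  (forall i j z, S z -> ccover c i (f z) -> ccover c j (f z) ->
     s i z = cval c i j (f z) + s j z).

Variables (W : set T) (c : cech1 T G).
Hypothesis cW : local_system W c.

Let cover_open i : open (ccover c i). Proof. by case: cW. Qed.

Lemma local_system_cover x : W x -> exists i, ccover c i x.
Proof. by case: cW => _ <- _ _ [i _ ?]; exists i. Qed.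

Lemma near_cover (P : topologicalType) (f : P -> T) i z :
  {for z, continuous f} -> ccover c i (f z) ->
  \forall w \near z, ccover c i (f w).
Proof. by move=> fc fz; apply: fc; apply: open_nbhs_nbhs. Qed.

(** In every trivialization the cocycle cancels in the difference of two flat
sections, so the difference does not depend on the index. *)
Lemma flat_section_diff (P : topologicalType) (S : set P) (f : P -> T)
    (s s' : cix c -> P -> G) :
  (forall z, S z -> {for z, continuous f}) -> (forall z, S z -> W (f z)) ->
  open S ->
  flat_section S f s -> flat_section S f s' ->
  exists2 d : P -> G, locconst S d &
    forall i z, S z -> ccover c i (f z) -> s i z = s' i z + d z.
Proof.
move=> fc fW oS [sl sc] [s'l s'c].
have /choice[ix hix] : forall z, exists o : option (cix c),
    S z -> exists2 i, o = Some i & ccover c i (f z).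
  move=> z; have [Sz|] := pselect (S z); last by exists None.
  by have [i hi] := local_system_cover (fW _ Sz); exists (Some i) => _; exists i.
pose d z := if ix z is Some i then s i z - s' i z else 0.
have dE i z : S z -> ccover c i (f z) -> d z = s i z - s' i z.
  move=> Sz iz; rewrite /d; have [j -> jz] := hix _ Sz.
  by rewrite (sc j i z)// (s'c j i z)// opprD addrACA subrr add0r.
exists d => [z Sz|i z Sz iz]; last by rewrite (dE i)// addrC subrK.
have [i hi] := local_system_cover (fW _ Sz).
near=> w.
have Sw : S w by near: w; apply: open_nbhs_nbhs.
have iw : ccover c i (f w) by near: w; apply: near_cover => //; apply: fc.
rewrite (dE i)// (dE i z)//; congr (_ - _); near: w; [exact: sl|exact: s'l].
Unshelve. all: by end_near. Qed.

(** In the trivialization [i0] a flat section is an arbitrary locally constant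
function [g]; the cocycle transports it to the other indices. *)
Lemma flat_section_const (P : topologicalType) (S : set P) (f : P -> T) i0 g :
  (forall z, S z -> {for z, continuous f}) ->
  (forall z, S z -> ccover c i0 (f z)) ->
  locconst S g -> flat_section S f (fun j z => cval c j i0 (f z) + g z).
Proof.
case: (cW) => _ _ cl cc fc f0 gl; split=> [i z Sz iz|i j z Sz iz jz].
  near=> w; congr (_ + _); last by near: w; apply: gl.
  near: w; apply: (fc _ Sz (fun v => cval c i i0 v = cval c i i0 (f z))).
  by apply: cl; split=> //; apply: f0.
by rewrite addrA cc//; apply: f0.
Unshelve. all: by end_near. Qed.

Lemma flat_section_comp (P Q : topologicalType) (S : set P) (S' : set Q)
    (f : P -> T) (g : Q -> P) (s : cix c -> P -> G) :
  (forall z, S' z -> {for z, continuous g}) -> (forall z, S' z -> S (g z)) ->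
  flat_section S f s ->
  flat_section S' (f \o g) (fun i => s i \o g).
Proof.
move=> gc gS [sl sc]; split=> [i z Sz iz|i j z Sz iz jz] /=; last exact/sc/jz/iz/gS.
exact: (gc _ Sz (fun w => s i w = s i (g z)) (sl _ _ (gS _ Sz) iz)).
Qed.

Lemma flat_section_sub (P : topologicalType) (S S' : set P) (f : P -> T) (s : cix c -> P -> G) :
  S' `<=` S -> flat_section S f s -> flat_section S' f s.
Proof.
by move=> sS [sl sc]; split=> [i z /sS|i j z /sS]; [exact: sl | exact: sc].
Qed.

Lemma flat_section_eq (P : topologicalType) (S : set P) (f f' : P -> T) (s : cix c -> P -> G) :
  (forall z, S z -> f z = f' z) -> flat_section S f s -> flat_section S f' s.
Proof.
move=> ff [sl sc]; split=> [i z Sz|i j z Sz]; rewrite -ff//; [exact: sl | exact: sc].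
Qed.

Lemma flat_section_glue (P : topologicalType) (A B : set P) (f : P -> T)
    (s s' : cix c -> P -> G) :
  (forall z, (A `|` B) z -> {for z, continuous f}) ->
  open A -> open B ->
  (forall i z, A z -> B z -> ccover c i (f z) -> s i z = s' i z) ->
  flat_section A f s -> flat_section B f s' ->
  flat_section (A `|` B) f (fun i z => if z \in A then s i z else s' i z).
Proof.
move=> fc oA oB ss' [sl sc] [s'l s'c].
have onB i z : B z -> ccover c i (f z) ->
    (if z \in A then s i z else s' i z) = s' i z.
  by case: ifPn => // /set_mem; exact: ss'.
split=> [i z zAB iz|i j z zAB iz jz].
- have [Az|nAz] := pselect (A z).
    near=> w.
    have Aw : A w by near: w; apply: open_nbhs_nbhs.
    by rewrite !mem_set//; near: w; exact: sl.
  have Bz : B z by case: zAB.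
  near=> w.
  have Bw : B w by near: w; apply: open_nbhs_nbhs.
  have iw : ccover c i (f w) by near: w; apply: near_cover => //; apply: fc.
  by rewrite !onB//; near: w; exact: s'l.
- case: ifPn => [/set_mem Az|/negP nAz]; first exact: sc.
  by apply: s'c => //; case: zAB => // /mem_set.
Unshelve. all: by end_near. Qed.

End FlatSections.

(** * Homotopy lifting *)

Section Homotopy.
Context {R : realType} {T P : topologicalType} {G : zmodType}.
Variables (W : set T) (c : cech1 T G).
Hypothesis cW : local_system W c.

(** Extending a homotopy by constants outside [[0, 1]] makes the time domain
open, so that flat sections have full neighborhoods to be constant on. *)
Definition clamp (t : R) : R := Num.max 0 (Num.min t 1).

Lemma clamp_itv t : 0 <= clamp t <= 1.
Proof. by rewrite /clamp le_max lexx /= ge_max ler01 ge_min lexx orbT. Qed.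

Lemma clamp_id t : 0 <= t <= 1 -> clamp t = t.
Proof. by move=> /andP[t0 t1]; rewrite /clamp min_l// max_r. Qed.

Lemma clamp_le0 t : t <= 0 -> clamp t = 0.
Proof. by move=> t0; rewrite /clamp min_l ?max_l// (le_trans t0). Qed.

Lemma continuous_clamp : continuous clamp.
Proof.
have -> : clamp = (cst 0 : R -> R^o) \max ((id : R -> R^o) \min (cst 1 : R -> R^o)).
  by apply/funext.
move=> t; apply: continuous_max; first exact: cvg_cst.
by apply: continuous_min; [exact: cvg_id | exact: cvg_cst].
Qed.

Section Lift.
Variables (S : set P) (h : P * R -> T) (s : cix c -> P -> G).
Hypothesis oS : open S.
Hypothesis hc : forall p, S p.1 -> {for p, continuous h}.
Hypothesis hW : forall p, S p.1 -> W (h p).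
Hypothesis h0 : forall z t, t <= 0 -> h (z, t) = h (z, 0).
Hypothesis sflat : flat_section S (fun z => h (z, 0)) s.

(** The lift is prescribed at time [-1], where [h] still has its initial value:
in this way it also makes sense to lift up to time [0]. *)
Definition local_lift (z : P) (t : R) := exists (O : set P) (s' : cix c -> P * R -> G),
  [/\ open O, O z, O `<=` S, flat_section [set p | O p.1 /\ p.2 < t] h s' &
      forall w i, O w -> ccover c i (h (w, 0)) -> s' i (w, -1) = s i w].

(** Real induction on the time: around [(z, u)] the homotopy stays in one
trivialization for a time [e], and there a lift known up to a time [v] close
to [u] is continued by keeping its coordinate constant. *)
Lemma local_lift_exists z t : S z -> 0 <= t -> local_lift z t.
Proof.
move=> Sz t0; apply: (@real_induction _ _ 0).
- exists S, (fun i p => s i p.1); split=> //.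
  apply: (@flat_section_eq _ _ _ _ _ (fun p => h (p.1, 0))).
    by move=> [w v] /= [_ v0]; rewrite [RHS]h0// ltW.
  apply: (@flat_section_comp _ _ _ _ _ S _ (fun z => h (z, 0)) fst) => //.
    by move=> p _; exact: cvg_fst.
  by move=> p [].
- move=> u v uv [N0 [s' [oN Nz NS fs' s's]]]; exists N0, s'; split=> //.
  by apply: flat_section_sub fs' => p [? pu]; split=> //; exact: lt_le_trans uv.
move=> u /andP[u0 _].
have [i0 hi0] := local_system_cover cW (hW (p := (z, u)) Sz).
have := near_cover cW (hc (p := (z, u)) Sz) hi0.
move=> [[B C] [/= Bz /nbhs_ballP[e1 /= e10 e1C]] BC].
have [e [e0 e_le1 eC]] : exists e : R, [/\ 0 < e, e <= 1 & ball u e `<=` C].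
  exists (Num.min e1 1); rewrite lt_min e10 ltr01 ge_min lexx orbT; split=> //.
  by apply: subset_trans e1C; apply: le_ball; rewrite ge_min lexx.
exists (e / 2); first by rewrite divr_gt0.
move=> v hv [N0 [s' [oN Nz NS fs' s's]]].
pose N1 := N0 `&` interior B.
have oN' : open N1 by apply: openI => //; exact: open_interior.
have hB w r : N1 w -> u - e < r -> r < u + e -> ccover c i0 (h (w, r)).
  move=> [_ /interior_subset Bw] h1 h2; apply: (BC (w, r)); split=> //=.
  by apply: eC; rewrite /ball /= ltr_norml; apply/andP; split; lra.
have N1S w : N1 w -> S w by move=> [/NS].
pose A := [set p : P * R | N1 p.1 /\ p.2 < v].
pose B' := [set p : P * R | N1 p.1 /\ u - e < p.2 < u + e / 2].
have oA : open A.
  have -> : A = (fst @^-1` N1) `&` (snd @^-1` [set r | r < v]) by [].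
  apply: openI; first by apply: open_comp => // p _; exact: cvg_fst.
  by apply: open_comp => [p _|]; [exact: cvg_snd | exact: open_lt].
have oB' : open B'.
  have -> : B' = (fst @^-1` N1) `&` (snd @^-1` `]u - e, u + e / 2[%classic).
    by rewrite /B'; apply/seteqP; split=> p /=; rewrite in_itv /=.
  apply: openI; first by apply: open_comp => // p _; exact: cvg_fst.
  by apply: open_comp => [p _|]; [exact: cvg_snd | exact: interval_open].
have hcAB p : (A `|` B') p -> {for p, continuous h}.
  by move=> [[/N1S ? _]|[/N1S ? _]]; exact: hc.
have fA : flat_section A h s'.
  by apply: flat_section_sub fs' => p [[? _] ?].
(* t1 lies before v, hence in the domain of the old lift, and within e of u. *)
pose t1 := u - e / 2.
have s'const w r : N1 w -> u - e < r -> r < v -> r < u + e / 2 ->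
    s' i0 (w, r) = s' i0 (w, t1).
  move=> N1w r1 r2 r3.
  have loc a b : u - e < a -> b < v -> b < u + e / 2 ->
      locconst [set x | a <= x <= b] (fun x => s' i0 (w, x)).
    move=> a1 b1 b2 x /= /andP[ax xb].
    have := fA.1 i0 (w, x); rewrite /A /= => /(_ _ _)[].
    - by split=> //; lra.
    - by apply: hB => //; lra.
    move=> [B1 B2] [/= B1w B2x] hB12; near=> y; apply: (hB12 (w, y)).
    by split=> /=; [exact: nbhs_singleton | near: y].
  have [rt|tr] := leP r t1.
    apply: (@locconst_segment _ _ (fun x => s' i0 (w, x)) _ _ rt).
    by apply: loc => //; rewrite /t1; lra.
  apply/esym; apply: (@locconst_segment _ _ (fun x => s' i0 (w, x)) _ _ (ltW tr)).
  by apply: loc => //; rewrite /t1; lra.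
have fB : flat_section B' h (fun j p => cval c j i0 (h p) + s' i0 (p.1, t1)).
  apply: (@flat_section_const _ _ _ _ cW _ _ _ i0 (fun p => s' i0 (p.1, t1))).
  - by move=> p pB; apply: hcAB; right.
  - by move=> [w r] [/= N1w /andP[? ?]]; apply: hB => //; lra.
  - move=> p [N1p _].
    have := fA.1 i0 (p.1, t1); rewrite /A /= => /(_ _ _)[].
    + by split=> //; rewrite /t1; lra.
    + by apply: hB => //; rewrite /t1; lra.
    move=> [B1 B2] [/= B1w B2x] hB12; near=> y; apply: (hB12 (y.1, t1)).
    split=> /=; last exact: nbhs_singleton.
    by near: y; apply: (@cvg_fst _ _ (nbhs p.1) (nbhs p.2)).
(* On the overlap the old lift has in the trivialization i0 the constant
   coordinate s' i0 (w, t1), so the old lift and its continuation agree. *)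
have := flat_section_glue cW hcAB oA oB' _ fA fB.
move=> /(_ _)[].
  move=> i [w r] /= [/= N1w rv] [_ /andP[ur ru]] iw.
  rewrite (fA.2 i i0 (w, r) (conj N1w rv) iw); first by rewrite s'const.
  by apply: hB => //; move: ur ru => /=; lra.
move=> sl sc; eexists N1, _; split; [exact: oN'| | |split|].
- by split=> //; exact: nbhs_singleton (nbhs_interior Bz).
- exact: N1S.
- move=> i p [N1p pu]; apply: sl.
  have [pv|vp] := ltP p.2 v; [left|right] => //; split=> //; lra.
- move=> i j p [N1p pu]; apply: sc.
  have [pv|vp] := ltP p.2 v; [left|right] => //; split=> //; lra.
- move=> w i N1w iw /=; rewrite mem_set; first by apply: s's => //; case: N1w.
  by split=> //=; lra.
Unshelve. all: by end_near. Qed.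

(** Two local lifts over neighborhoods of different points agree on each path
[{w} * R], since they agree at its beginning and their difference is locally
constant; so they glue. *)
Lemma flat_section_lift :
  exists s' : cix c -> P -> G, flat_section S (fun z => h (z, 1)) s'.
Proof.
have /choice[F hF] : forall z, exists F : set P * (cix c -> P * R -> G), S z ->
    [/\ open F.1, F.1 z, F.1 `<=` S,
      flat_section [set p : P * R | F.1 p.1 /\ p.2 < 2] h F.2 &
      forall w i, F.1 w -> ccover c i (h (w, 0)) -> F.2 i (w, -1) = s i w].
  move=> z; have [Sz|] := pselect (S z); last first.
    by exists (set0, fun _ _ => 0).
  have [N0 [s' ?]] := local_lift_exists Sz (ler0n _ 2).
  by exists (N0, s').
have Funiq z w i : S z -> (F z).1 w -> ccover c i (h (w, 1)) ->
    (F w).2 i (w, 1) = (F z).2 i (w, 1).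
  move=> Sz zw iw.
  have [oz _ zS fz bz] := hF _ Sz.
  have Sw := zS _ zw.
  have [ow ww wS fw bw] := hF _ Sw.
  have pc : continuous (fun r : R => (w, r)).
    by move=> r; apply: continuous_pair; [exact: cvg_cst | exact: cvg_id].
  pose g r := h (w, r).
  have gc r : {for r, continuous g}.
    apply: (@continuous_comp _ _ _ (fun r => (w, r)) h); first exact: pc.
    exact: (hc (p := (w, r)) Sw).
  have o2 : open [set r : R | r < 2] by exact: open_lt.
  have fl x : S x -> (F x).1 w ->
      flat_section [set r : R | r < 2] g (fun i r => (F x).2 i (w, r)).
    move=> Sx xw; have [_ _ _ fx _] := hF _ Sx.
    apply: (@flat_section_comp _ _ c _ _ _ _ h (fun r : R => (w, r)) _ _ _ fx).
    - by move=> r _; exact: pc.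
    - by move=> r /= r2; split.
  have [d dl dE] := flat_section_diff cW (fun r _ => gc r)
    (fun r _ => hW (p := (w, r)) Sw) o2 (fl w Sw ww) (fl z Sz zw).
  have [i0 hi0] := local_system_cover cW (hW (p := (w, 0)) Sw).
  have i0m : ccover c i0 (g (-1)) by rewrite /g h0//; lra.
  have m2 : (-1 : R) < 2 by lra.
  have d0 : d (-1) = 0.
    have := dE i0 (-1) m2 i0m; rewrite bw// bz// => /esym.
    by rewrite -[RHS]addr0 => /addrI.
  have l2 : (1 : R) < 2 by lra.
  rewrite (dE i 1 l2 iw).
  suff -> : d 1 = 0 by rewrite addr0.
  rewrite -d0; apply/esym/locconst_segment; first by lra.
  by move=> r /= /andP[_ r1]; apply: dl => /=; lra.
exists (fun i w => (F w).2 i (w, 1)); split=> [i z Sz iz|i j z Sz iz jz].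
  have [oz zz zS fz _] := hF _ Sz.
  have [B1 [/= B1z B2] hB] : \forall p \near (z, 1 : R), (F z).2 i p = (F z).2 i (z, 1).
    by apply: fz.1 => //=; split=> //; lra.
  have hc1 : {for z, continuous (fun z => h (z, 1))}.
    apply: (@continuous_comp _ _ _ (fun z : P => (z, 1 : R)) h);
      last exact: (hc (p := (z, 1)) Sz).
    by apply: continuous_pair; [exact: cvg_id | exact: cvg_cst].
  near=> w; rewrite (Funiq z)//.
  - apply: (hB (w, 1)); split=> /=; last exact: nbhs_singleton.
    by near: w.
  - by near: w; apply: open_nbhs_nbhs.
  - by near: w; apply: (near_cover cW hc1).
have [oz zz zS fz _] := hF _ Sz.
by apply: fz.2 => //=; split=> //; lra.
Unshelve. all: by end_near. Qed.

End Lift.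

Lemma flat_section_homotopy (S : set P) (h : P * R -> T) :
  open S ->
  (forall z t, S z -> 0 <= t <= 1 -> {for (z, t), continuous h}) ->
  (forall z t, S z -> 0 <= t <= 1 -> W (h (z, t))) ->
  (exists s : cix c -> P -> G, flat_section S (fun z => h (z, 0)) s) ->
  exists s : cix c -> P -> G, flat_section S (fun z => h (z, 1)) s.
Proof.
move=> oS hc hW [s sf].
pose k (p : P * R) := (p.1, clamp p.2).
have kc p : {for p, continuous k}.
  apply: continuous_pair; first exact: cvg_fst.
  by apply: (@continuous_comp _ _ _ snd clamp); [exact: cvg_snd | exact: continuous_clamp].
have c0 : clamp 0 = 0 by rewrite clamp_id// lexx ler01.
have c1 : clamp 1 = 1 by rewrite clamp_id// lexx ler01.
have [||||s' fs'] := @flat_section_lift S (h \o k) s oS.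
- move=> p Sp; apply: continuous_comp; first exact: kc.
  by apply: hc => //; exact: clamp_itv.
- by move=> p Sp; apply: hW => //; exact: clamp_itv.
- by move=> z t t0; rewrite /= /k /= clamp_le0// c0.
- by apply: flat_section_eq sf => z _; rewrite /= /k /= c0.
by exists s'; apply: flat_section_eq fs' => z _; rewrite /= /k /= c1.
Qed.

End Homotopy.

(** * The topology of complex coordinate space *)

Section ComplexTopology.
Context {R : realType}.
Implicit Types (T : topologicalType) (z w : R[i]).

Lemma nbhs_complexP z (P : set R[i]) :
  nbhs z P <-> exists2 e : R, 0 < e & forall w, `|z - w| < (e%:C)%C -> P w.
Proof.
split=> [/nbhs_ballP[e /= e0 eP]|[e e0 eP]].
  have eR : e = ((complex.Re e)%:C)%C by rewrite RRe_real// gtr0_real.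
  exists (complex.Re e); first by rewrite -ltcR -eR.
  by move=> w; rewrite -eR; exact: eP.
by apply/nbhs_ballP; exists (e%:C)%C => //=; rewrite ltcR.
Qed.

Lemma continuous_Re : continuous (@complex.Re R).
Proof.
move=> z P /nbhs_ballP[e /= e0 eP]; apply/nbhs_complexP; exists e => // w zw.
apply: eP; rewrite /ball /= -ltcR; apply: le_lt_trans zw.
by have := normc_ge_Re (z - w); rewrite raddfB.
Qed.

Lemma normc_i : `|'i%C : R[i]| = 1.
Proof. by rewrite normc_def /= expr0n expr1n add0r sqrtr1. Qed.

Lemma continuous_Im : continuous (@complex.Im R).
Proof.
move=> z P /nbhs_ballP[e /= e0 eP]; apply/nbhs_complexP; exists e => // w zw.
apply: eP; rewrite /ball /= -ltcR; apply: le_lt_trans zw.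
have := normc_ge_Re ((z - w) * 'i%C).
by rewrite ReiNIm normrN raddfB normrM normc_i mulr1.
Qed.

Lemma normc_le_ReIm z : `|z| <= ((`|complex.Re z| + `|complex.Im z|)%:C)%C.
Proof.
rewrite [z in `|z|]complexE rmorphD; apply: (le_trans (ler_normD _ _)).
by rewrite normrM normc_i mul1r !normc_def /= expr0n !addr0 !sqrtr_sqr.
Qed.

Lemma continuous_Complex T (f g : T -> R) x :
  {for x, continuous f} -> {for x, continuous g} ->
  {for x, continuous (fun y => Complex (f y) (g y))}.
Proof.
move=> fc gc P /nbhs_complexP[e e0 eP].
have e20 : 0 < e / 2 by rewrite divr_gt0.
near=> y; apply: eP; apply: (le_lt_trans (normc_le_ReIm _)).
rewrite ltcR /= (splitr e) ltrD//.
- by near: y; apply: (fc (ball (f x) (e / 2))); exact: nbhsx_ballx.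
- by near: y; apply: (gc (ball (g x) (e / 2))); exact: nbhsx_ballx.
Unshelve. all: by end_near. Qed.

Lemma continuous_row (K : numFieldType) n T (f : 'I_n -> T -> K) x :
  (forall j, {for x, continuous (f j)}) ->
  {for x, continuous (fun y => \row_j f j y)}.
Proof.
move=> fc P [Q xQ QP].
have : \forall y \near x, forall j, Q 0 j (f j y).
  apply: filter_forall => j; apply: (fc j).
  by have := xQ 0 j; rewrite mxE.
by apply: filterS => y Qy; apply: QP => i j; rewrite ord1 mxE; exact: Qy.
Qed.

Lemma continuous_ReCoord n (j : 'I_n) :
  continuous (fun v : 'rV[R[i]]_n => complex.Re (v 0 j)).
Proof.
move=> v; apply: (@continuous_comp _ _ _ (fun v : 'rV[R[i]]_n => v 0 j)).
  exact: coord_continuous.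
exact: continuous_Re.
Qed.

Lemma continuous_ImCoord n (j : 'I_n) :
  continuous (fun v : 'rV[R[i]]_n => complex.Im (v 0 j)).
Proof.
move=> v; apply: (@continuous_comp _ _ _ (fun v : 'rV[R[i]]_n => v 0 j)).
  exact: coord_continuous.
exact: continuous_Im.
Qed.

End ComplexTopology.

(** * Thickenings of the real punctured square *)

Section Tube.
Context {R : realType}.
Local Notation C2 := 'rV[R[i]]_2.

Definition mkpt (x y : 'I_2 -> R) : C2 := \row_j Complex (x j) (y j).
Definition Rept (z : C2) (j : 'I_2) : R := complex.Re (z 0 j).
Definition Impt (z : C2) (j : 'I_2) : R := complex.Im (z 0 j).

Lemma Rept_mkpt x y : Rept (mkpt x y) = x.
Proof. by apply/funext => j; rewrite /Rept mxE. Qed.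

Lemma mkptK z : mkpt (Rept z) (Impt z) = z.
Proof. by apply/rowP => j; rewrite mxE /Rept /Impt; case: (z 0 j). Qed.

Lemma continuous_mkpt (T : topologicalType) (x y : T -> 'I_2 -> R) p :
  (forall j, {for p, continuous (x ^~ j)}) ->
  (forall j, {for p, continuous (y ^~ j)}) ->
  {for p, continuous (fun q => mkpt (x q) (y q))}.
Proof.
move=> xc yc; apply: (@continuous_row R[i] 2 T (fun j q => Complex (x q j) (y q j))).
by move=> j; apply: continuous_Complex.
Qed.

Lemma continuous_Rept j : continuous (Rept ^~ j).
Proof. exact: continuous_ReCoord. Qed.

Lemma continuous_Impt j : continuous (Impt ^~ j).
Proof. exact: continuous_ImCoord. Qed.

Definition segment_pt (b x : 'I_2 -> R) (t : R) (j : 'I_2) : R :=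
  (1 - t) * b j + t * x j.

(** A thickening has no point above the origin, so a contraction to [b] has to
avoid it. *)
Definition star_about (b : 'I_2 -> R) (Q : set ('I_2 -> R)) :=
  [/\ Q b, (forall j, `|b j| < 1), ~ Q (fun=> 0) &
      forall x t, Q x -> 0 <= t <= 1 -> Q (segment_pt b x t)].

(** These properties make [Y] retract onto the real square without its center:
first the imaginary parts are shrunk, then only real points remain. *)
Record thickening (Y : set C2) : Prop := {
  thick_open : open Y;
  thick_box : Y `<=` K2;
  thick_re : forall x, (forall j, `|x j| < 1) -> x <> (fun=> 0) ->
    Y (mkpt x (fun=> 0));
  thick_scale : forall z t, Y z -> 0 <= t <= 1 ->
    Y (mkpt (Rept z) (fun j => t * Impt z j)) }.

Variable Y : set C2.
Hypothesis Yth : thickening Y.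

Definition above (Q : set ('I_2 -> R)) : set C2 := Y `&` [set z | Q (Rept z)].

(** The two homotopies that contract the part of a thickening above a set that is
star-shaped about [b]: the second starts where the first one arrives. *)
Definition shrink_im (p : C2 * R) : C2 :=
  mkpt (Rept p.1) (fun j => p.2 * Impt p.1 j).
Definition contract_re b (p : C2 * R) : C2 :=
  mkpt (segment_pt b (Rept p.1) p.2) (fun=> 0).

Lemma continuous_shrink_im : continuous shrink_im.
Proof.
move=> p.
apply: (@continuous_mkpt _ (fun p : C2 * R => Rept p.1)
  (fun (p : C2 * R) j => p.2 * Impt p.1 j)) => j.
  by apply: (@continuous_comp _ _ _ fst (Rept ^~ j)); [exact: cvg_fst|exact: continuous_Rept].
apply: (@continuousM _ _ snd (fun p : C2 * R => Impt p.1 j)); first exact: cvg_snd.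
by apply: (@continuous_comp _ _ _ fst (Impt ^~ j)); [exact: cvg_fst|exact: continuous_Impt].
Qed.

Lemma continuous_contract_re b : continuous (contract_re b).
Proof.
move=> p.
apply: (@continuous_mkpt _ (fun p : C2 * R => segment_pt b (Rept p.1) p.2)
  (fun _ _ => 0)) => j; last exact: cvg_cst.
apply: (@continuousD _ _ _ (fun p : C2 * R => (1 - p.2) * b j)
  (fun p : C2 * R => p.2 * Rept p.1 j)).
  apply: (@continuousM _ _ (fun p : C2 * R => 1 - p.2) (cst (b j))); last exact: cvg_cst.
  by apply: (@continuousB R R^o _ (cst 1) (snd : C2 * R -> R^o));
    [exact: cvg_cst | exact: cvg_snd].
apply: (@continuousM _ _ snd (fun p : C2 * R => Rept p.1 j)); first exact: cvg_snd.
by apply: (@continuous_comp _ _ _ fst (Rept ^~ j)); [exact: cvg_fst|exact: continuous_Rept].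
Qed.

Lemma segment_pt_lt1 b x t j : `|b j| < 1 -> `|x j| < 1 -> 0 <= t <= 1 ->
  `|segment_pt b x t j| < 1.
Proof.
rewrite /segment_pt !ltr_norml => /andP[b1 b2] /andP[x1 x2] /andP[t0 t1].
have [->|tn0] := eqVneq t 0; first by apply/andP; split; lra.
have tp : 0 < t by rewrite lt_neqAle eq_sym tn0.
have h1 : 0 < t * (1 - x j) by apply: mulr_gt0; lra.
have h2 : 0 < t * (x j + 1) by apply: mulr_gt0; lra.
have h3 : 0 <= (1 - t) * (1 - b j) by apply: mulr_ge0; lra.
have h4 : 0 <= (1 - t) * (b j + 1) by apply: mulr_ge0; lra.
by apply/andP; split; lra.
Qed.

Section Star.
Variables (b : 'I_2 -> R) (Q : set ('I_2 -> R)).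
Hypothesis Qb : star_about b Q.

Lemma above_shrink z t : above Q z -> 0 <= t <= 1 -> above Q (shrink_im (z, t)).
Proof.
move=> [Yz Qz] t01; split; last by rewrite /= /shrink_im Rept_mkpt.
exact: thick_scale.
Qed.

Lemma above_contract z t : above Q z -> 0 <= t <= 1 ->
  above Q (contract_re b (z, t)).
Proof.
move=> [Yz Qz] t01; have [Qbb b1 Q0 Qs] := Qb.
have Qst : Q (segment_pt b (Rept z) t) by exact: Qs.
split; last by rewrite /= /contract_re Rept_mkpt.
apply: thick_re => //=.
  by move=> j; apply: segment_pt_lt1 => //; have [] := thick_box Yth Yz j.
by move=> e; apply: Q0; rewrite -e.
Qed.

Lemma shrink1 z : shrink_im (z, 1) = z.
Proof.
rewrite /shrink_im /= -[RHS]mkptK; congr mkpt.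
by apply/funext => j; rewrite mul1r.
Qed.

Lemma shrink0 z : shrink_im (z, 0) = contract_re b (z, 1).
Proof.
by congr mkpt; apply/funext => j; rewrite /segment_pt /= ?subrr ?mul0r ?add0r ?mul1r.
Qed.

Lemma contract0 z : contract_re b (z, 0) = mkpt b (fun=> 0).
Proof.
by congr mkpt; apply/funext => j; rewrite /segment_pt /= subr0 mul1r mul0r addr0.
Qed.

(** Above [Q] the contraction to the single point [b] lifts. *)
Lemma star_flat_section (G : zmodType) (c : cech1 C2 G) :
  local_system Y c -> open (above Q) ->
  exists s : cix c -> C2 -> G, flat_section (above Q) id s.
Proof.
move=> cY oQ.
have [Qbb b1 Q0 _] := Qb.
have Yb : Y (mkpt b (fun=> 0)).
  by apply: thick_re => // e; apply: Q0; rewrite -e.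
have [i0 hi0] := local_system_cover cY Yb.
have s0 : exists s : cix c -> C2 -> G,
    flat_section (above Q) (fun z => contract_re b (z, 0)) s.
  exists (fun j z => cval c j i0 (contract_re b (z, 0)) + 0).
  apply: (flat_section_const cY (g := fun=> 0)).
  - move=> z _; apply: (@continuous_comp _ _ _ (fun z : C2 => (z, 0 : R)) (contract_re b)).
      by apply: continuous_pair; [exact: cvg_id | exact: cst_continuous].
    exact: continuous_contract_re.
  - by move=> z _; rewrite contract0.
  - exact: locconst_cst.
have s1 := flat_section_homotopy cY oQ
  (fun z t _ _ => @continuous_contract_re b (z, t))
  (fun z t Qz t01 => (above_contract Qz t01).1) s0.
have s1' : exists s : cix c -> C2 -> G,
    flat_section (above Q) (fun z => shrink_im (z, 0)) s.
  by have [s fs] := s1; exists s; apply: flat_section_eq fs => z _; rewrite shrink0.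
have [s fs] := flat_section_homotopy cY oQ
  (fun z t _ _ => @continuous_shrink_im (z, t))
  (fun z t Qz t01 => (above_shrink Qz t01).1) s1'.
by exists s; apply: flat_section_eq fs => z _; rewrite shrink1.
Qed.

(** The two contractions join [z] to [b] inside the set. *)
Lemma star_locconst (G : Type) (d : C2 -> G) z :
  locconst (above Q) d -> above Q z -> d z = d (mkpt b (fun=> 0)).
Proof.
move=> dl Qz.
have path (h : C2 * R -> C2) : continuous h ->
    (forall t, 0 <= t <= 1 -> above Q (h (z, t))) -> d (h (z, 0)) = d (h (z, 1)).
  move=> hc hQ; apply: (@locconst_segment R _ (fun t => d (h (z, t))) _ _ ler01).
  move=> t t01.
  have hc' : {for t, continuous (fun t => h (z, t))}.
    apply: (@continuous_comp _ _ _ (fun t : R => (z, t)) h); last exact: hc.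
    by apply: continuous_pair; [exact: cst_continuous | exact: cvg_id].
  exact: (hc' (fun w => d w = d (h (z, t))) (dl _ (hQ _ t01))).
rewrite -[in LHS](shrink1 z) -(path shrink_im); last 2 first.
- exact: continuous_shrink_im.
- by move=> t; exact: above_shrink.
rewrite shrink0 -(path (contract_re b)) ?contract0//.
- exact: continuous_contract_re.
- by move=> t; exact: above_contract.
Qed.

End Star.

(** The complements of the two half lines that issue from the center along the
first axis; they meet in the two half squares that follow. *)
Definition slit_right : set ('I_2 -> R) := [set x | 0 < x 0 \/ x 1 != 0].
Definition slit_left : set ('I_2 -> R) := [set x | x 0 < 0 \/ x 1 != 0].
Definition half_up : set ('I_2 -> R) := [set x | 0 < x 1].
Definition half_down : set ('I_2 -> R) := [set x | x 1 < 0].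

Definition vec2 (x0 x1 : R) (j : 'I_2) : R := if j == 0 then x0 else x1.

Lemma vec2_lt1 x0 x1 j : `|x0| < 1 -> `|x1| < 1 -> `|vec2 x0 x1 j| < 1.
Proof. by rewrite /vec2; case: ifP. Qed.

Lemma half_lt1 : `|1 / 2 : R| < 1.
Proof. by rewrite ger0_norm; lra. Qed.

Lemma star_up : star_about (vec2 0 (1 / 2)) half_up.
Proof.
split; rewrite /half_up /vec2 /=.
- by lra.
- by move=> j; apply: vec2_lt1; rewrite ?normr0 ?half_lt1.
- by rewrite ltxx.
move=> x t x1 /andP[t0 t1]; rewrite /segment_pt /=.
by have [->|tn0] := eqVneq t 0; [lra | nra].
Qed.

Lemma star_down : star_about (vec2 0 (- (1 / 2))) half_down.
Proof.
split; rewrite /half_down /vec2 /=.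
- by lra.
- by move=> j; apply: vec2_lt1; rewrite ?normr0 ?normrN ?half_lt1.
- by rewrite ltxx.
move=> x t x1 /andP[t0 t1]; rewrite /segment_pt /=.
by have [->|tn0] := eqVneq t 0; [lra | nra].
Qed.

Lemma star_R : star_about (vec2 (1 / 2) 0) slit_right.
Proof.
split; rewrite /slit_right /vec2 /=.
- by left; lra.
- by move=> j; apply: vec2_lt1; rewrite ?normr0 ?half_lt1.
- by case; rewrite ?ltxx ?eqxx.
move=> x t Qx /andP[t0 t1]; rewrite /segment_pt /=.
have [->|tn0] := eqVneq t 0; first by left; lra.
have tp : 0 < t by rewrite lt_neqAle eq_sym tn0.
case: Qx => [x0|x1]; last by right; rewrite mulr0 add0r mulf_neq0.
by left; have := mulr_gt0 tp x0; nra.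
Qed.

Lemma star_L : star_about (vec2 (- (1 / 2)) 0) slit_left.
Proof.
split; rewrite /slit_left /vec2 /=.
- by left; lra.
- by move=> j; apply: vec2_lt1; rewrite ?normr0 ?normrN ?half_lt1.
- by case; rewrite ?ltxx ?eqxx.
move=> x t Qx /andP[t0 t1]; rewrite /segment_pt /=.
have [->|tn0] := eqVneq t 0; first by left; lra.
have tp : 0 < t by rewrite lt_neqAle eq_sym tn0.
case: Qx => [x0|x1]; last by right; rewrite mulr0 add0r mulf_neq0.
have nx0 : 0 < - x 0 by rewrite oppr_gt0.
by left; have := mulr_gt0 tp nx0; nra.
Qed.

Lemma open_Rept_gt j : open [set z : C2 | 0 < Rept z j].
Proof.
apply: (@open_comp _ _ (Rept ^~ j) [set r | 0 < r]); last exact: open_gt.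
by move=> z _; exact: continuous_Rept.
Qed.

Lemma open_Rept_lt j : open [set z : C2 | Rept z j < 0].
Proof.
apply: (@open_comp _ _ (Rept ^~ j) [set r | r < 0]); last exact: open_lt.
by move=> z _; exact: continuous_Rept.
Qed.

Lemma open_above_up : open (above half_up).
Proof. by apply: openI; [exact: thick_open | exact: open_Rept_gt]. Qed.

Lemma open_above_down : open (above half_down).
Proof. by apply: openI; [exact: thick_open | exact: open_Rept_lt]. Qed.

Lemma open_Rept_neq j : open [set z : C2 | Rept z j != 0].
Proof.
have -> : [set z : C2 | Rept z j != 0] =
    [set z | 0 < Rept z j] `|` [set z | Rept z j < 0].
  apply/seteqP; split=> z /=; first by rewrite neq_lt => /orP[]; [right|left].
  by rewrite neq_lt => -[->|->]; rewrite ?orbT.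
by apply: openU; [exact: open_Rept_gt | exact: open_Rept_lt].
Qed.

Lemma open_above_R : open (above slit_right).
Proof.
apply: openI; first exact: thick_open.
by apply: openU; [exact: open_Rept_gt | exact: open_Rept_neq].
Qed.

Lemma open_above_L : open (above slit_left).
Proof.
apply: openI; first exact: thick_open.
by apply: openU; [exact: open_Rept_lt | exact: open_Rept_neq].
Qed.

Section Monodromy.
Context {G : zmodType}.

(** Sections over the two slit parts, normalized to agree on the upper half; going
around the center changes the section by [m]. *)
Definition has_monodromy (c : cech1 C2 G) (sR sL : cix c -> C2 -> G) (m : G) :=
  [/\ flat_section (above slit_right) id sR, flat_section (above slit_left) id sL,
      forall i z, above half_up z -> ccover c i z -> sL i z = sR i z &
      forall i z, above half_down z -> ccover c i z -> sL i z = sR i z + m].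

Lemma above_sub Q Q' : Q `<=` Q' -> above Q `<=` above Q'.
Proof. by move=> QQ z [? ?]; split=> //; exact: QQ. Qed.

(** The two halves are star-shaped, so the difference of the sections given by
[star_flat_section] is one constant on each of them; subtracting the one of the
upper half normalizes the left section. *)
Lemma monodromy_exists (c : cech1 C2 G) : local_system Y c ->
  exists sR sL m, @has_monodromy c sR sL m.
Proof.
move=> cY.
have [sR fR] := star_flat_section star_R cY open_above_R.
have [sL fL] := star_flat_section star_L cY open_above_L.
have side Q b : star_about b Q -> open (above Q) -> Q `<=` slit_right -> Q `<=` slit_left ->
    exists d, forall i z, above Q z -> ccover c i z -> sL i z = sR i z + d.
  move=> Qb oQ QQR QQL.
  have [||d dl dE] := flat_section_diff cY (S := above Q) (f := id) _ _ oQ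
    (flat_section_sub (above_sub QQL) fL) (flat_section_sub (above_sub QQR) fR).
  - by move=> z _; exact: cvg_id.
  - by move=> z [].
  exists (d (mkpt b (fun=> 0))) => i z Qz iz.
  by rewrite (dE i z)// (star_locconst Qb dl Qz).
have [dp hp] : exists d, forall i z, above half_up z -> ccover c i z ->
    sL i z = sR i z + d.
  by apply: (side _ _ star_up open_above_up) => x /= x1; right; rewrite gt_eqF.
have [dm hm] : exists d, forall i z, above half_down z -> ccover c i z ->
    sL i z = sR i z + d.
  by apply: (side _ _ star_down open_above_down) => x /= x1; right; rewrite lt_eqF.
exists sR, (fun i z => sL i z - dp), (dm - dp); split=> //.
- case: fL => fl fc; split=> [i z Sz iz|i j z Sz iz jz].
    by apply: filterS (fl i z Sz iz) => w ->.
  by rewrite (fc i j)// addrA.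
- by move=> i z Qz iz; rewrite hp// addrK.
- by move=> i z Qz iz; rewrite hm// addrA.
Qed.

End Monodromy.

End Tube.

(** * The monodromy around the circle *)

Section Loop.
Context {R : realType}.
Local Notation C2 := 'rV[R[i]]_2.
Variable Y : set C2.
Hypothesis Yth : thickening Y.

Let sqrt2_gt0 : 0 < Num.sqrt 2 :> R.
Proof. by rewrite sqrtr_gt0. Qed.

Lemma circleCE t : circleC t = mkpt (vec2 (cos (2 * pi * t) / Num.sqrt 2 : R)
  (sin (2 * pi * t) / Num.sqrt 2)) (fun=> 0).
Proof. by apply/rowP => j; rewrite !mxE /vec2; case: ifP. Qed.

Lemma Rept_circleC0 t : Rept (circleC t) 0 = cos (2 * pi * t) / Num.sqrt 2 :> R.
Proof. by rewrite circleCE Rept_mkpt. Qed.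

Lemma Rept_circleC1 t : Rept (circleC t) 1 = sin (2 * pi * t) / Num.sqrt 2 :> R.
Proof. by rewrite circleCE Rept_mkpt. Qed.

Lemma circleC_in t : Y (circleC t).
Proof.
rewrite circleCE; apply: (thick_re Yth).
  have h (x : R) : -1 <= x <= 1 -> `|x / Num.sqrt 2| < 1.
    move=> x1; rewrite normrM normfV (gtr0_norm sqrt2_gt0) ltr_pdivrMr// mul1r.
    rewrite -[ltLHS]ger0_norm// -sqrtr_sqr ltr_sqrt//.
    rewrite real_normK ?num_real//; nra.
  by move=> j; apply: vec2_lt1; apply: h; rewrite ?cos_geN1 ?cos_le1 ?sin_geN1 ?sin_le1.
move=> e; have := cos2Dsin2 (2 * pi * t : R).
have /eqP := congr1 (fun f => f 0) e; have /eqP := congr1 (fun f => f 1) e.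
rewrite /vec2 /= !mulf_eq0 !invr_eq0 !(gt_eqF sqrt2_gt0) !orbF => /eqP -> /eqP ->.
by rewrite expr0n addr0 => /esym/eqP; rewrite oner_eq0.
Qed.

Lemma continuous_circleC : continuous (@circleC R).
Proof.
have -> : @circleC R = fun t => mkpt (vec2 (cos (2 * pi * t) / Num.sqrt 2 : R)
  (sin (2 * pi * t) / Num.sqrt 2)) (fun=> 0).
  by apply/funext => t; exact: circleCE.
have lin (f : R -> R) t : continuous f ->
    {for t, continuous (fun t => f (2 * pi * t) / Num.sqrt 2)}.
  move=> fc; apply: (@continuousM _ _ (fun t => f (2 * pi * t)) (cst (Num.sqrt 2)^-1)).
    apply: (@continuous_comp _ _ _ (fun t => 2 * pi * t) f); last exact: fc.
    by apply: (@continuousM _ _ (cst (2 * pi)) id); [exact: cst_continuous | exact: cvg_id].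
  exact: cst_continuous.
move=> t; apply: (@continuous_mkpt R R (fun t => vec2 (cos (2 * pi * t) / Num.sqrt 2 : R)
  (sin (2 * pi * t) / Num.sqrt 2)) (fun _ _ => 0)) => j; last exact: cst_continuous.
rewrite /vec2; case: (j == 0); apply: lin; [exact: continuous_cos | exact: continuous_sin].
Qed.

Lemma near_gt (x y : R) : x < y -> \forall z \near y, x < z.
Proof. by move=> xy; apply: open_nbhs_nbhs; split=> //; exact: open_gt. Qed.

Let pi0 := pi_gt0 R.

Lemma circleC_up t : 0 < t < 1 / 2 -> above Y half_up (circleC t).
Proof.
move=> t01; split; first exact: circleC_in.
rewrite /= /half_up /= Rept_circleC1 divr_gt0//; apply: sin_gt0_pi.
have [t0 t1] := andP t01.
have h1 : 0 < pi * t by rewrite mulr_gt0.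
have h2 : 0 < pi * (1 / 2 - t) by rewrite mulr_gt0//; lra.
by apply/andP; split; lra.
Qed.

Lemma circleC_down t : 1 / 2 < t < 1 -> above Y half_down (circleC t).
Proof.
move=> t01; split; first exact: circleC_in.
rewrite /= /half_down /= Rept_circleC1 pmulr_llt0 ?invr_gt0//.
rewrite -[2 * pi * t](subrK pi) sinDpi oppr_lt0; apply: sin_gt0_pi.
have [t0 t1] := andP t01.
have h1 : 0 < pi * (t - 1 / 2) by rewrite mulr_gt0//; lra.
have h2 : 0 < pi * (1 - t) by rewrite mulr_gt0//; lra.
by apply/andP; split; lra.
Qed.

Lemma circleC_L t : 1 / 4 < t < 3 / 4 -> above Y slit_left (circleC t).
Proof.
move=> t01; split; first exact: circleC_in.
rewrite /= /slit_left /= Rept_circleC0 pmulr_llt0 ?invr_gt0//; left.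
rewrite -[2 * pi * t](subrK pi) cosDpi oppr_lt0; apply: cos_gt0_pihalf.
have [t0 t1] := andP t01.
have h1 : 0 < pi * (t - 1 / 4) by rewrite mulr_gt0//; lra.
have h2 : 0 < pi * (3 / 4 - t) by rewrite mulr_gt0//; lra.
by apply/andP; split; lra.
Qed.

Lemma circleC_R t : 0 <= t <= 1 -> t != 1 / 2 -> above Y slit_right (circleC t).
Proof.
move=> /andP[t0 t1] th; split; first exact: circleC_in.
have up u : above Y half_up (circleC u) -> slit_right (Rept (circleC u)).
  by move=> [_ /= h]; right; rewrite gt_eqF.
have down u : above Y half_down (circleC u) -> slit_right (Rept (circleC u)).
  by move=> [_ /= h]; right; rewrite lt_eqF.
have [->|tn0] := eqVneq t 0.
  by left; rewrite Rept_circleC0 mulr0 cos0 divr_gt0.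
have [->|tn1] := eqVneq t 1.
  by left; rewrite Rept_circleC0 mulr1 mulr_natl cos2pi divr_gt0.
have tp : 0 < t by rewrite lt_neqAle eq_sym tn0.
have tl : t < 1 by rewrite lt_neqAle tn1.
have [h|h|h] := ltgtP t (1 / 2).
- by apply: up; apply: circleC_up; rewrite tp.
- by apply: down; apply: circleC_down; rewrite h.
- by rewrite h eqxx in th.
Qed.

Lemma circleC01 : circleC 1 = circleC 0 :> C2.
Proof. by rewrite !circleCE mulr1 mulr0 mulr_natl cos2pi sin2pi cos0 sin0. Qed.

Section LoopSum.
Context {G : zmodType}.
Variables (c : cech1 C2 G) (sR sL : cix c -> C2 -> G) (m : G).
Hypothesis cY : local_system Y c.
Hypothesis cm : has_monodromy Y sR sL m.

(* A flat section along the loop: the circle lies over the right slit square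
   except at t = 1 / 2 and over the left one for 1 / 4 < t < 3 / 4. *)
Let sg (i : cix c) (t : R) : G :=
  if t < 1 / 4 then sR i (circleC t)
  else if t < 3 / 4 then sL i (circleC t) else sR i (circleC t) + m.

Let in01 (t : R) := 0 <= t <= 1.

Let sg_loc i t : in01 t -> ccover c i (circleC t) ->
  \forall u \near t, sg i u = sg i t.
Proof.
case: cm => fR fL up down t01 it.
have [t0 t1] : 0 <= t /\ t <= 1 by apply/andP.
have nc := near_cover cY (continuous_circleC (x := t)) it.
(* Near t the section is one of the three branches. *)
have branch Q (f : cix c -> C2 -> G) : flat_section (above Y Q) id f ->
    above Y Q (circleC t) -> \forall u \near t, f i (circleC u) = f i (circleC t).
  move=> ff Qt; exact: (continuous_circleC (x := t) (ff.1 i _ Qt it)).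
have concl (f : R -> G) : (\forall u \near t, f u = f t) ->
    (\forall u \near t, sg i u = f u) -> \forall u \near t, sg i u = sg i t.
  move=> ft sf; have sft := nbhs_singleton sf.
  by rewrite /= sft; apply: filterS2 ft sf => u <- ->.
have [tlt|tge] := ltP t (1 / 2).
  apply: (concl (fun u => sR i (circleC u))).
    by apply: branch fR _; apply: circleC_R; rewrite ?lt_eqF.
  apply: filterS2 (lt_nbhsl tlt) nc => u u2 iu; rewrite /sg; case: (ltP u (1 / 4)) => // u4.
  by rewrite (_ : u < 3 / 4) ?up//; [apply: circleC_up|]; lra.
have [tle|tgt] := leP t (1 / 2).
  apply: (concl (fun u => sL i (circleC u))).
    by apply: branch fL _; apply: circleC_L; lra.
  have h1 : 1 / 4 < t by lra.
  have h2 : t < 3 / 4 by lra.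
  apply: filterS2 (lt_nbhsl h2) (near_gt h1) => u u2 u1.
  by rewrite /sg u2 ltNge ltW.
apply: (concl (fun u => sR i (circleC u) + m)).
  have : \forall u \near t, sR i (circleC u) = sR i (circleC t).
    by apply: branch fR _; apply: circleC_R; rewrite ?gt_eqF.
  by apply: filterS => u ->.
apply: filterS2 (near_gt tgt) nc => u u2 iu; rewrite /sg.
case: (ltP u (1 / 4)) => [u4|u4]; first by exfalso; lra.
by case: (ltP u (3 / 4)) => // u3; rewrite down//; apply: circleC_down; lra.
Qed.

Let sg_cocycle i j t : in01 t -> ccover c i (circleC t) ->
  ccover c j (circleC t) -> sg i t = cval c i j (circleC t) + sg j t.
Proof.
case: cm => fR fL up down /[dup] t01 /andP[t0 t1] it jt; rewrite /sg.
case: (ltP t (1 / 4)) => t4; first by apply: fR.2 => //; apply: circleC_R => //; apply/eqP; lra.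
case: (ltP t (3 / 4)) => t3.
  have [e|ne] := eqVneq t (1 / 4); last first.
    by apply: fL.2 => //; apply: circleC_L; rewrite t3 andbT lt_neqAle eq_sym ne.
  have u2 : 0 < t < 1 / 2 by lra.
  rewrite !up//; try exact: circleC_up.
  by apply: fR.2 => //; apply: circleC_R => //; apply/eqP; lra.
rewrite addrA; congr (_ + _).
by apply: fR.2 => //; apply: circleC_R => //; apply/eqP; lra.
Qed.

(** Follow a flat section along the loop.  In the trivialization [idx s] it is
constant on the [s]-th arc, and at the end of the arc the transition value is
the difference of two successive coordinates; so the sum telescopes to the
difference between the start and the end, which is [- m]. *)
Lemma loop_monodromy N (t : nat -> R) (idx : nat -> cix c) :
  t 0%N = 0 -> t N = 1 -> idx N = idx 0%N ->
  (forall s, (s < N)%N -> t s <= t s.+1 /\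
     forall u, t s <= u <= t s.+1 -> ccover c (idx s) (circleC u)) ->
  \sum_(s < N) cval c (idx s) (idx s.+1) (circleC (t s.+1)) = - m.
Proof.
move=> t0 tN idxN tidx.
have N0 : (0 < N)%N.
  by case: N tN {idxN tidx} => // e; have := @ltr01 R; rewrite -e t0 ltxx.
have tmono s r : (s <= r <= N)%N -> t s <= t r.
  elim: r => [|r IH] /andP[sr rN].
    by move: sr; rewrite leqn0 => /eqP ->.
  move: sr; rewrite leq_eqVlt => /orP[/eqP -> //|]; rewrite ltnS => sr.
  by apply: (le_trans (IH _)); [rewrite sr ltnW | case: (tidx r rN)].
have t01 s u : (s < N)%N -> t s <= u <= t s.+1 -> in01 u.
  move=> sN /andP[su us]; apply/andP; split.
    by apply: le_trans su; rewrite -t0; apply: tmono; rewrite leq0n ltnW.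
  by apply: (le_trans us); rewrite -tN; apply: tmono; rewrite sN leqnn.
have cov s : (s <= N)%N -> ccover c (idx s) (circleC (t s)).
  rewrite leq_eqVlt => /orP[/eqP ->|sN].
    rewrite idxN tN circleC01 -t0; have [le01 h] := tidx _ N0.
    by apply: h; rewrite lexx.
  by have [le h] := tidx _ sN; apply: h; rewrite lexx.
have step s : (s < N)%N -> cval c (idx s) (idx s.+1) (circleC (t s.+1)) =
    sg (idx s) (t s) - sg (idx s.+1) (t s.+1).
  move=> sN; have [le h] := tidx _ sN.
  have -> : sg (idx s) (t s) = sg (idx s) (t s.+1).
    apply: (locconst_segment le) => u /= us; apply: sg_loc.
      exact: t01 us.
    exact: h.
  rewrite (@sg_cocycle (idx s) (idx s.+1))//; first by rewrite addrK.
  - by apply: (t01 s) => //; rewrite le lexx.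
  - by apply: h; rewrite le lexx.
  - exact: cov.
rewrite (eq_bigr (fun s : 'I_N => - (sg (idx s.+1) (t s.+1) - sg (idx s) (t s)))); last first.
  by move=> s _; rewrite step// opprB.
rewrite -(big_mkord xpredT (fun s => - (sg (idx s.+1) (t s.+1) - sg (idx s) (t s)))).
rewrite sumrN telescope_sumr// idxN t0 tN /sg circleC01.
have -> : (0 : R) < 1 / 4 by lra.
have -> : (1 : R) < 1 / 4 = false by apply/negbTE; rewrite -leNgt; lra.
have -> : (1 : R) < 3 / 4 = false by apply/negbTE; rewrite -leNgt; lra.
by rewrite addrC addKr.
Qed.

End LoopSum.
End Loop.

(** * Every cocycle is a multiple of the generator *)

Section Multiple.
Context {R : realType}.
Local Notation C2 := 'rV[R[i]]_2.
Variable Y : set C2.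
Hypothesis Yth : thickening Y.
Hypothesis YD : Y `<=` D2.
Variable a : cech1 C2 int.
Hypothesis ha : is_generator a.

Let aY : cech1 C2 int := cech_restrict Y a.

Lemma generator_local_system : local_system Y aY.
Proof.
have [[ao aD al ac] _] := ha.
split=> /=.
- by move=> i; apply: openI; [exact: (thick_open Yth) | exact: ao].
- apply/seteqP; split=> [z [i _ []//]|z Yz].
  by have := YD Yz; rewrite -aD => -[i _ iz]; exists i.
- move=> i j z [[_ iz] [_ jz]]; exact: al.
- by move=> i j p z [_ ?] [_ ?] [_ ?]; exact: ac.
Qed.

(** The circle lies in [Y], so its pairing with [a] is computed from the
restriction of [a] to [Y]. *)
Lemma generator_monodromy : exists sR sL, @has_monodromy _ Y _ aY sR sL (-1).
Proof.
have [sR [sL [m hm]]] := monodromy_exists Yth generator_local_system.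
exists sR, sL; suff <- : m = -1 by [].
have [_ [N [t [idx [t0 tN idxN tidx sum1]]]]] := ha.
rewrite -[m]opprK; congr (- _).
rewrite -(loop_monodromy Yth generator_local_system hm t0 tN idxN)//.
move=> s sN; have [le h] := tidx s sN; split=> // u /h hu; split=> //.
exact: circleC_in.
Qed.

(** With [l := - m], where [m] is the monodromy of [n], the cocycle [n - l a] has
monodromy [0], so its sections over the two slit parts agree on both halves and
define a section [s] over [Y]. *)
Lemma multiple_of_generator (G : zmodType) (n : cech1 C2 G) :
  local_system Y n ->
  exists (l : G) (s : cix n -> cix a -> C2 -> G),
    (forall j p z, Y z -> ccover n j z -> ccover a p z ->
       \forall w \near z, s j p w = s j p z) /\
    (forall j j' p q z, Y z -> ccover n j z -> ccover n j' z ->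
       ccover a p z -> ccover a q z ->
       cval n j j' z + s j' q z = s j p z + l *~ cval a p q z).
Proof.
move=> nY.
have [nR [nL [m [fnR fnL nup ndown]]]] := monodromy_exists Yth nY.
have [aR [aL [faR faL aup adown]]] := generator_monodromy.
pose sR j p z := nR j z - (- m) *~ aR p z.
pose sL j p z := nL j z - (- m) *~ aL p z.
pose inR z := above Y slit_right z.
have LR j p z : above Y slit_right z -> above Y slit_left z -> ccover n j z -> ccover a p z ->
    sL j p z = sR j p z.
  move=> [Yz Rz] [_ Lz] jz pz.
  have x1 : Rept z 1 != 0.
    by case: Rz => // x0; case: Lz => // x0'; move: (lt_trans x0 x0'); rewrite ltxx.
  move: x1; rewrite /sL /sR neq_lt => /orP[x1|x1].
    rewrite ndown// adown// mulrzDr mulrNz mulNrz !opprD addrACA.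
    by rewrite mulr1z !opprK subrr addr0.
  by rewrite nup// aup.
exists (- m), (fun j p z => if z \in above Y slit_right then sR j p z else sL j p z).
have inL z : Y z -> ~ above Y slit_right z -> above Y slit_left z.
  move=> Yz nR'; split=> //; have nR'' : ~ slit_right (Rept z) by move=> ?; apply: nR'.
  have [x1|x1] := eqVneq (Rept z 1) 0; last by right.
  left; rewrite ltNge le_eqVlt; apply/negP => /orP[/eqP x0|x0]; last by apply: nR''; left.
  have [_ /(_ _)] := YD Yz; apply; move=> j.
  by have [->|->] : j = 0 \/ j = 1; [case: j => -[|[|//]] ?; [left|right]; apply/val_inj | |].
have onL j p z : above Y slit_left z -> ccover n j z -> ccover a p z ->
    (if z \in above Y slit_right then sR j p z else sL j p z) = sL j p z.
  by move=> Lz jz pz; case: ifP => // /set_mem Rz; rewrite LR.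
split=> [j p z Yz jz pz|j j' p q z Yz jz j'z pz qz].
  have id_c : {for z, continuous (@id C2)} by exact: cvg_id.
  have [Rz|nRz] := pselect (above Y slit_right z).
    have h : \forall w \near z, above Y slit_right w.
      by apply: open_nbhs_nbhs; split=> //; exact: open_above_R.
    near=> w; have Rw : above Y slit_right w by near: w.
    rewrite !mem_set// /sR; congr (_ - _ *~ _); near: w.
      exact: fnR.1.
    by apply: faR.1 => //; split.
  have Lz := inL _ Yz nRz.
  have h : \forall w \near z, above Y slit_left w.
      by apply: open_nbhs_nbhs; split=> //; exact: open_above_L.
  near=> w; have Lw : above Y slit_left w by near: w.
  have jw : ccover n j w by near: w; exact: (near_cover nY id_c jz).
  have pw : ccover aY p w.
    by near: w; apply: (near_cover generator_local_system id_c); split.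
  case: (pw) => _ pw'.
  rewrite !onL// /sL; congr (_ - _ *~ _); near: w.
    exact: fnL.1.
  by apply: faL.1 => //; split.
have fin (sn : cix n -> C2 -> G) (sa : cix a -> C2 -> int) :
    sn j z = cval n j j' z + sn j' z -> sa p z = cval a p q z + sa q z ->
    cval n j j' z + (sn j' z - (- m) *~ sa q z) =
    (sn j z - (- m) *~ sa p z) + (- m) *~ cval a p q z.
  move=> -> ->; rewrite -[RHS]addrA mulrzDr opprD.
  by rewrite (addrAC (- _) (- _)) addNr add0r addrA.
have pY : ccover aY p z by split.
have qY : ccover aY q z by split.
case: ifPn => [/set_mem Rz|/negP nRz].
  by apply: fin; [apply: fnR.2 | apply: (faR.2 p q z Rz)].
have Lz : above Y slit_left z by apply: inL => // Rz; apply: nRz; apply: mem_set.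
by apply: fin; [apply: fnL.2 | apply: (faL.2 p q z Lz)].
Unshelve. all: by end_near. Qed.

End Multiple.

(** * Holomorphic roots of complex numbers *)

Section PowerQuotient.
Context {K : numFieldType}.

(** The quotient of [u ^+ k - v ^+ k] by [u - v]: being nonzero near the diagonal
it makes the [k]-th power locally injective and its inverse differentiable. *)
Definition powq (k : nat) (u v : K) : K := \sum_(i < k) u ^+ (k.-1 - i) * v ^+ i.

Lemma powqE k u v : u ^+ k - v ^+ k = (u - v) * powq k u v.
Proof. by rewrite subrXX. Qed.

Lemma powqxx k u : powq k u u = k%:R * u ^+ k.-1.
Proof.
rewrite /powq (eq_bigr (fun=> u ^+ k.-1)) ?sumr_const ?card_ord ?mulr_natl// => i _.
by rewrite -exprD subnK//; case: k i => [[]//|k] i; rewrite -ltnS.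
Qed.

Lemma powq_neq0 k u : (0 < k)%N -> u != 0 -> powq k u u != 0.
Proof.
by move=> k0 u0; rewrite powqxx mulf_neq0 ?expf_neq0// pnatr_eq0 -lt0n.
Qed.

Lemma cvg_powq {T : Type} (F : set_system T) {FF : Filter F} k (f g : T -> K) (u v : K) :
  f @ F --> u -> g @ F --> v -> (fun t => powq k (f t) (g t)) @ F --> powq k u v.
Proof.
move=> fu gv; rewrite /powq.
have cvgX (h : T -> K) (w : K) n : h @ F --> w -> (fun t => h t ^+ n) @ F --> w ^+ n.
  move=> hw; elim: n => [|n IH]; first by rewrite expr0; exact: cvg_cst.
  by rewrite exprS; under eq_fun do rewrite exprS; exact: cvgM.
move: k.-1 => N; elim: k => [|k IH].
  by rewrite big_ord0; under eq_fun do rewrite big_ord0; exact: cvg_cst.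
rewrite big_ord_recr /=; under eq_fun do rewrite big_ord_recr /=.
by apply: cvgD IH _; apply: cvgM; exact: cvgX.
Qed.

Lemma near_dist (u v d : K) : `|u - v| < d -> \forall w \near v, `|u - w| < d.
Proof.
move=> uv; apply/nbhs_ballP; exists (d - `|u - v|) => /=; first by rewrite subr_gt0.
move=> w; rewrite /ball /= ltrBrDl => h; apply: le_lt_trans h.
by rewrite -(subrKA v) ler_normD.
Qed.

Lemma cvg_add_cst (w : K) : (fun h : K => h + w) @ 0 --> w.
Proof.
have h : {for (0 : K), continuous (fun h : K => h + w)}.
  by apply: (@continuousD _ K^o _ id (cst w)); [exact: cvg_id | exact: cst_continuous].
by rewrite -[X in _ --> X]add0r.
Qed.

Lemma near_neq0 (u : K) : u != 0 -> \forall x \near u, x != 0.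
Proof.
move=> u0; apply/nbhs_ballP; exists `|u| => /=; first by rewrite normr_gt0.
by move=> x; apply: contraTneq => ->; rewrite /ball /= subr0 ltxx.
Qed.

Lemma powX_inj_near k (u : K) : (0 < k)%N -> u != 0 ->
  exists2 d : K, 0 < d & forall v w, `|u - v| < d -> `|u - w| < d ->
    v ^+ k = w ^+ k -> v = w.
Proof.
move=> k0 u0.
have h : (fun p : K * K => powq k p.1 p.2) @ (nbhs u, nbhs u) --> powq k u u.
  by apply: cvg_powq; [exact: cvg_fst | exact: cvg_snd].
have /h : nbhs (powq k u u) [set x | x != 0].
  by apply: near_neq0; exact: powq_neq0.
move=> [[A B] [/= uA uB] hAB].
have /nbhs_ballP[d /= d0 hd] : nbhs u (A `&` B) by exact: filterI.
exists d => // v w v1 w1 vw.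
have ne : powq k v w != 0.
  by have /= := hAB (v, w) (conj (hd _ v1).1 (hd _ w1).2).
apply/eqP; rewrite -subr_eq0; have /eqP := powqE k v w.
by rewrite vw subrr eq_sym mulf_eq0 (negPf ne) orbF.
Qed.

Lemma locconst_root {T : topologicalType} (k : nat) (f : T -> K) x :
  (0 < k)%N -> f x != 0 -> {for x, continuous f} ->
  (\forall y \near x, f y ^+ k = f x ^+ k) -> \forall y \near x, f y = f x.
Proof.
move=> k0 fx fc fk; have [d d0 hd] := powX_inj_near k0 fx.
have : \forall y \near x, `|f x - f y| < d.
  by apply: (fc (ball (f x) d)); exact: nbhsx_ballx.
by apply: filterS2 fk => y yk yd; apply: hd; rewrite ?subrr ?normr0.
Qed.

End PowerQuotient.

Section RootBranch.
Context {R : realType}.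
Local Notation C := R[i].
Implicit Types z w : C.

(** The element of [s] closest to [z] will do. *)
Lemma norm_prod_root z (s : seq C) : s != [::] ->
  exists2 x, x \in s & `|z - x| ^+ size s <= \prod_(y <- s) `|z - y|.
Proof.
elim: s => // y s IH _; have [->|s0] := eqVneq s [::].
  by exists y; [exact: mem_head | rewrite big_seq1 expr1].
have [x xs hx] := IH s0; rewrite big_cons /=.
have [le|/ltW le] := real_leP (normr_real (z - y)) (normr_real (z - x)).
  exists y; first exact: mem_head.
  rewrite exprS; apply: ler_wpM2l; first exact: normr_ge0.
  by apply: le_trans hx; apply: lerXn2r; rewrite ?nnegrE ?normr_ge0.
exists x; first by rewrite in_cons xs orbT.
by rewrite exprS ler_pM// exprn_ge0.
Qed.

(** The product over the [k]-th roots [x] of [w] of the distances from [z] to [x]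
is [`|z ^+ k - w|]. *)
Lemma near_root k z w : (0 < k)%N ->
  exists2 x, x ^+ k = w & `|z - x| ^+ k <= `|z ^+ k - w|.
Proof.
move=> k0; pose p : {poly C} := 'X^k - w%:P.
have pm : p \is monic by exact: monicXnsubC.
have [s sp] := closed_field_poly_normal p.
rewrite (monicP pm) scale1r in sp.
have ss : size s = k.
  by have := size_XnsubC w k0; rewrite -/p sp size_prod_XsubC => -[].
have s0 : s != [::] by rewrite -size_eq0 ss -lt0n.
have [x xs hx] := norm_prod_root z s0; exists x.
  have : root p x by rewrite sp root_prod_XsubC.
  by rewrite /root /p !hornerE subr_eq0 => /eqP.
rewrite -ss; apply: le_trans hx _; rewrite -normr_prod ss.
have -> : z ^+ k - w = p.[z] by rewrite /p !hornerE.
rewrite sp horner_prod; under [in leRHS]eq_bigr do rewrite hornerXsubC.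
exact: lexx.
Qed.

(** Choose a [k]-th root [z0] of [w0] and for each [w] a [k]-th root close to [z0]:
by [near_root] there is one, and by [powX_inj_near] it is the only one near
[z0].  The same two facts applied at another point [w1] give continuity there.
The difference quotients of [r] at [w] are the inverses of values of [powq],
hence they converge. *)
Lemma root_branch k w0 : (0 < k)%N -> w0 != 0 ->
  exists r : C -> C,
    \forall w \near w0, r w ^+ k = w /\ differentiable (r : C -> C^o) w.
Proof.
move=> k0 w00.
have [z0 z0k _] := near_root 0 w0 k0.
have z00 : z0 != 0.
  by apply: contra w00 => /eqP z0e; rewrite -z0k z0e expr0n eqn0Ngt k0.
have [d d0 hd] := powX_inj_near k0 z00.
have /choice[r hr] : forall w, exists x : C, x ^+ k = w /\ `|z0 - x| ^+ k <= `|w0 - w|.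
  by move=> w; have [x xk hx] := near_root z0 w k0; exists x; rewrite -z0k.
have rd w : `|w0 - w| < d ^+ k -> `|z0 - r w| < d.
  move=> h; rewrite -(ltr_pXn2r k0) ?nnegrE//; last exact: ltW.
  by apply: le_lt_trans h; case: (hr w).
have dk0 : 0 < d ^+ k by rewrite exprn_gt0.
have nd : \forall w \near w0, `|w0 - w| < d ^+ k.
  by apply: near_dist; rewrite subrr normr0.
have rc w1 : `|w0 - w1| < d ^+ k -> {for w1, continuous r}.
  move=> w1d P /nbhs_ballP[e /= e0 eP].
  pose e' := d - `|z0 - r w1|.
  have e'0 : 0 < e' by rewrite subr_gt0 rd.
  have near_w1 b : 0 < b -> \forall w \near w1, `|w1 - w| < b ^+ k.
    by move=> b0; apply: near_dist; rewrite subrr normr0 exprn_gt0.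
  have n1 := near_w1 _ e0; have n1' := near_w1 _ e'0; have n2 := near_dist w1d.
  suff : \forall w \near w1, P (r w) by [].
  near=> w; apply: eP.
  have [x xk hx] := near_root (r w1) w k0.
  have [r1k _] := hr w1; have [rwk _] := hr w.
  have small b : 0 < b -> `|w1 - w| < b ^+ k -> `|r w1 - x| < b.
    move=> b0 wb; rewrite -(ltr_pXn2r k0) ?nnegrE//; last exact: ltW.
    by apply: le_lt_trans wb; rewrite -[in X in _ <= X]r1k.
  have xe : `|r w1 - x| < e by apply: small; [|near: w].
  have xd : `|r w1 - x| < e' by apply: small; [|near: w].
  rewrite /ball /= (hd (r w) x)//.
  - by apply: rd; near: w.
  - rewrite -(subrKA (r w1)); apply: (le_lt_trans (ler_normD _ _)).
    by rewrite -ltrBrDl.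
  - by rewrite rwk.
exists r.
apply: filterS2 nd (near_neq0 w00) => w wd w_neq0.
split; first by case: (hr w).
have [rwk _] := hr w.
have rw0 : r w != 0.
  by apply: contra w_neq0 => /eqP e; rewrite -rwk e expr0n eqn0Ngt k0.
have wc := rc _ wd.
apply/derivable1_diffP; apply/cvg_ex; exists (powq k (r w) (r w))^-1 => /=.
have hc : (fun h : C => r (h *: (1 : C^o) + w)) @ 0 --> r w.
  have h0 : (fun h : C => h *: (1 : C^o) + w) @ 0 --> w.
    have -> : (fun h : C => h *: (1 : C^o) + w) = (fun h => h + w).
      by apply/funext => h; rewrite [_ *: _]mulr1.
    exact: cvg_add_cst.
  exact: (cvg_comp _ _ h0 wc).
have hq : (fun h : C => (powq k (r (h *: (1 : C^o) + w)) (r w))^-1) @ 0^' -->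
    (powq k (r w) (r w))^-1.
  apply: cvgV; first exact: powq_neq0.
  apply: cvg_powq; last exact: cvg_cst.
  exact: cvg_within_filter hc.
apply: cvg_trans hq; apply: near_eq_cvg.
near=> h.
have h0 : h != 0 by near: h; exact: nbhs_dnbhs_neq.
have [rhk _] := hr (h *: (1 : C^o) + w).
have E : h = (r (h *: (1 : C^o) + w) - r w) * powq k (r (h *: (1 : C^o) + w)) (r w).
  by rewrite -powqE rhk rwk addrK [RHS]mulr1.
rewrite /=; move: E.
set q := powq _ _ _; set d1 := _ - _ => E.
have q0 : q != 0 by apply: contra h0 => /eqP q0; rewrite E q0 mulr0.
have d10 : d1 != 0 by apply: contra h0 => /eqP d10; rewrite E d10 mul0r.
rewrite -[RHS]/(h^-1 * d1) (_ : h^-1 = (d1 * q)^-1); last by rewrite -E.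
by rewrite invfM mulrC mulrA divff// mul1r.
Unshelve. all: by end_near. Qed.
End RootBranch.

(** * Roots of unity and the transition functions of the model bundle *)

Section Germ.
Context {K : numFieldType} {V W : normedModType K}.

Lemma near0_differentiable (f : V -> W) x :
  (\forall y \near x, f y = 0) -> differentiable f x.
Proof.
move=> f0; have fx : f x = 0 := nbhs_singleton f0.
have o0 : f \o shift x = cst (f x) + (\0 : {linear V -> W}) +o_ 0 id.
  apply/eqaddoP => _ /posnumP[e]; near=> h.
  have -> : (f \o shift x - (cst (f x) + (\0 : {linear V -> W}))) h =
    f (h + x) - (f x + 0) by [].
  rewrite fx addr0 subr0 (_ : f (h + x) = 0) ?normr0 ?mulr_ge0//.
  near: h; have := f0; rewrite (near_shift 0) /= subr0.
  by apply: filterS.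
have c0 : continuous (\0 : {linear V -> W}) by exact: cst_continuous.
apply/diff_locallyP; rewrite (diff_unique c0 o0); split; [exact: c0|exact: o0].
Unshelve. all: by end_near. Qed.

Lemma near_eq_differentiable (f g : V -> W) x :
  (\forall y \near x, f y = g y) -> differentiable f x -> differentiable g x.
Proof.
move=> fg df; have -> : g = f + (g - f) by rewrite addrC subrK.
apply: differentiableD => //; apply: near0_differentiable.
apply: filterS fg => y fgy.
  have -> : (g - f) y = g y - f y by [].
  by rewrite fgy; apply/eqP; rewrite subr_eq0.
Qed.

End Germ.

Section RootsOfUnity.
Context {R : realType}.
Local Notation C := R[i].

Lemma cexpD (x y : C) : cexp (x + y) = cexp x * cexp y.
Proof.
case: x y => [x1 x2] [y1 y2]; rewrite /cexp /= expRD cosD sinD.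
by apply/eqP; rewrite eq_complex /=; apply/andP; split; apply/eqP; ring.
Qed.

Lemma cexp0 : cexp 0 = 1 :> C.
Proof. by rewrite /cexp /= expR0 cos0 sin0 mulr1 mulr0. Qed.

Lemma cexp_neq0 (x : C) : cexp x != 0.
Proof.
apply/eqP => e; have := cexpD x (- x); rewrite subrr cexp0 e mul0r => /eqP.
by rewrite oner_eq0.
Qed.

Variables (k : nat) (hk : (1 < k)%N).

Definition twopii : C := Complex 0 (2 * pi).

(** The primitive root [exp (2 pi i / k)], which is the value of the model
transition functions for [l = 1] and cocycle value [1]. *)
Definition zeta : C := cexp (twopii / k%:R).

Lemma twopiiE (x : R) : twopii * (x%:C)%C = Complex 0 (2 * pi * x).
Proof.
apply/eqP; rewrite eq_complex /=; apply/andP; split; apply/eqP; ring.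
Qed.

Lemma zetaX n : zeta ^+ n = cexp (twopii * (n%:R / k%:R)).
Proof.
elim: n => [|n IH]; first by rewrite expr0 mul0r mulr0 cexp0.
by rewrite exprS IH /zeta -cexpD -mulrDr -natr1 mulrDl mul1r addrC.
Qed.

Lemma zeta_prim : k.-primitive_root zeta.
Proof.
have k0 : (0 < k)%N by exact: ltnW.
have zk : zeta ^+ k = 1.
  rewrite zetaX divff ?pnatr_eq0 -?lt0n// (_ : (1 : C) = (1%:C)%C)// twopiiE mulr1.
  by rewrite /cexp /= expR0 mulr_natl cos2pi sin2pi !mul1r.
have [m mp mk] := prim_order_exists k0 zk.
suff -> : k = m by [].
apply/eqP; rewrite eqn_leq (dvdn_leq k0 mk) andbT leqNgt; apply/negP => mlt.
have := prim_expr_order mp; rewrite zetaX.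
have m0 := prim_order_gt0 mp.
have -> : m%:R / k%:R = ((m%:R / k%:R : R)%:C)%C :> C by rewrite rmorphM fmorphV !rmorph_nat.
rewrite twopiiE /cexp /= expR0 !mul1r => /eqP.
rewrite eq_complex /= => /andP[/eqP + _].
set x : R := m%:R / k%:R.
have x0 : 0 < x by rewrite divr_gt0 ?ltr0n.
have x1 : x < 1 by rewrite ltr_pdivrMr ?ltr0n// mul1r ltr_nat.
have -> : 2 * pi * x = pi * x *+ 2 by rewrite -mulrA mulr_natl.
rewrite cos_mulr2n => c1.
(* cos (2 pi x) = 1 forces sin (pi x) = 0, impossible for 0 < x < 1. *)
have : sin (pi * x) = 0.
  by have := cos2Dsin2 (pi * x); move: c1; move: (cos _) (sin _) => u v; nra.
have : 0 < sin (pi * x).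
  apply: sin_gt0_pi; apply/andP; split; first by rewrite mulr_gt0 ?pi_gt0.
  by rewrite gtr_pMr ?pi_gt0.
by move=> s0 s1; rewrite s1 ltxx in s0.
Qed.

(** The isomorphism of Z/k with the group of [k]-th roots of unity. *)
Definition chi (x : 'Z_k) : C := zeta ^+ x.

Lemma chiD x y : chi (x + y) = chi x * chi y.
Proof.
rewrite /chi -exprD /= -(prim_expr_mod zeta_prim (x + y)%N).
by congr (zeta ^+ (_ %% _)); exact: Zp_cast.
Qed.

Lemma chi0 : chi 0 = 1.
Proof. by rewrite /chi expr0. Qed.

Lemma chi_neq0 x : chi x != 0.
Proof. by rewrite expf_neq0// cexp_neq0. Qed.

Lemma chi_inj : injective chi.
Proof.
move=> x y /eqP; rewrite (eq_prim_root_expr zeta_prim) => /eqP e.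
apply/val_inj; rewrite /=.
by rewrite -(modn_small (m := x) (d := k)) ?e ?modn_small// -[ltnRHS](Zp_cast hk).
Qed.

Lemma chi_surj (w : C) : w ^+ k = 1 -> exists x, w = chi x.
Proof.
move=> wk; have [i ->] := prim_rootP zeta_prim wk.
exists (inZp i); rewrite /chi /= -(prim_expr_mod zeta_prim i).
by congr (zeta ^+ (_ %% _)); rewrite Zp_cast.
Qed.

(** Both sides turn sums of [m] into products and agree at [1]. *)
Lemma F_bundle_transition (l : 'Z_k) (m : int) :
  cexp (twopii * (((l : nat)%:R / k%:R) * m%:~R)) = chi (l *~ m).
Proof.
pose e (n : int) : C := cexp (twopii * (((l : nat)%:R / k%:R) * n%:~R)).
have eD n p : e (n + p) = e n * e p by rewrite /e intrD !mulrDr cexpD.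
have e1 : e 1 = chi l by rewrite /e mulr1 /chi zetaX.
have e0 : e 0 = 1 by rewrite /e !mulr0 cexp0.
have en (n : nat) : e n = chi (l *~ n).
  elim: n => [|n IH]; first by rewrite e0 mulr0z chi0.
  by rewrite -addn1 PoszD eD IH e1 mulrzDr mulr1z chiD.
rewrite -/(e m); case: m => n //.
rewrite NegzE; apply: (mulIf (chi_neq0 (l *~ n.+1))).
by rewrite -chiD mulrNz addNr chi0 -en -eD addNr.
Qed.

End RootsOfUnity.

(** * Line bundles with a trivial power *)

Section Torsion.
Context {R : realType}.
Local Notation C := R[i].
Local Notation C2 := 'rV[R[i]]_2.
Local Notation std := (std_atlas R 2).

Lemma std_holomorphicP (W : set C2) (f : C2 -> C) :
  holomorphic std W f <-> forall z, W z -> differentiable (f : C2 -> C^o) z.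
Proof.
split=> [hf z Wz|hf phi z -> Wz _]; last exact: hf.
by have := hf (Chart setT id id) z erefl Wz I.
Qed.

Lemma line_bundle_diag (n : nat) (X : topologicalType) (A : set (chart R n X))
    (W : set X) (L : cech1 X C) i x :
  line_bundle A W L -> ccover L i x -> cval L i i x = 1.
Proof.
move=> [_ _ Lu Lc] ix; have := Lc i i i x ix ix ix.
have [_ /(_ x (conj ix ix)) gn0] := Lu i i.
by rewrite -[RHS]mulr1 => /(mulfI gn0).
Qed.

Variables (k : nat) (hk : (1 < k)%N).
Let k0 : (0 < k)%N := ltnW hk.

Variables (Y : set C2) (Yth : thickening Y) (YD : Y `<=` D2).
Variables (a : cech1 C2 int) (ha : is_generator a).
Variables (L : cech1 C2 C) (h : cix L -> C2 -> C).
Hypothesis hL : line_bundle std Y L.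
Hypothesis hu : forall i, holomorphic_unit std (ccover L i) (h i).
Hypothesis hg : forall i j z, ccover L i z -> ccover L j z ->
  h i z * cval L i j z ^+ k = h j z.

Let Lopen i : open (ccover L i). Proof. by case: hL. Qed.
Let LY i z : ccover L i z -> Y z.
Proof. by case: hL => _ <- _ _; exists i. Qed.
Let Lcov z : Y z -> exists i, ccover L i z.
Proof. by case: hL => _ <- _ _ [i _ ?]; exists i. Qed.
Let hn0 i z : ccover L i z -> h i z != 0.
Proof. by case: (hu i) => _; apply. Qed.
Let hd i z : ccover L i z -> differentiable (h i : C2 -> C^o) z.
Proof. by case: (hu i) => /std_holomorphicP + _; apply. Qed.
Let gd i j z : ccover L i z -> ccover L j z ->
  differentiable (cval L i j : C2 -> C^o) z.
Proof. by case: hL => _ _ Lu _ iz jz; case: (Lu i j) => /std_holomorphicP + _; apply. Qed.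

(** Compose a branch of the [k]-th root with the inverse of [h i]. *)
Lemma local_root i z0 : ccover L i z0 -> exists (B : set C2) (r : C2 -> C),
  [/\ open B, B z0, B `<=` ccover L i &
      forall z, B z -> r z ^+ k * h i z = 1 /\ differentiable (r : C2 -> C^o) z].
Proof.
move=> iz0.
have w0 : (h i z0)^-1 != 0 by rewrite invr_eq0 hn0.
have [r0 hr0] := root_branch k0 w0.
have dinv : differentiable ((fun z => (h i z)^-1) : C2 -> C^o) z0.
  by apply: differentiableV; [exact: hd | exact: hn0].
have near1 : \forall z \near z0, r0 (h i z)^-1 ^+ k = (h i z)^-1 /\
    differentiable (r0 : C -> C^o) (h i z)^-1.
  exact: (differentiable_continuous dinv hr0).
have near2 : \forall z \near z0, ccover L i z by apply: open_nbhs_nbhs.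
pose P z := (r0 (h i z)^-1 ^+ k = (h i z)^-1 /\
    differentiable (r0 : C -> C^o) (h i z)^-1) /\ ccover L i z.
have nP : nbhs z0 P by apply: filterI.
exists (interior P), (fun z => r0 (h i z)^-1); split.
- exact: open_interior.
- exact: nbhs_singleton (nbhs_interior nP).
- by move=> z /interior_subset [].
move=> z /interior_subset [[rk rd] iz]; split.
  by rewrite rk mulVf// hn0.
have dz : differentiable ((fun z => (h i z)^-1) : C2 -> C^o) z.
  by apply: differentiableV; [exact: hd | exact: hn0].
exact: (differentiable_comp dz rd).
Qed.

(** The frames of [L] rescaled by the local roots of [local_root] have transition
functions in the [k]-th roots of unity.  Their logarithms form a Z/k-cocycle
[n], indexed by a trivialization and by the point around which the root is
taken.  A flat section of [n - l a] then gives, after exponentiation and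
multiplication by the local roots, the required isomorphism. *)
Lemma torsion_bundle_iso : exists l : 'Z_k,
  bundle_iso std (cech_restrict Y (F_bundle k l a)) L.
Proof.
have /choice[br hbr] : forall j : cix L * C2, exists b : set C2 * (C2 -> C),
    ccover L j.1 j.2 ->
    [/\ open b.1, b.1 j.2, b.1 `<=` ccover L j.1 &
      forall z, b.1 z -> b.2 z ^+ k * h j.1 z = 1 /\
        differentiable (b.2 : C2 -> C^o) z].
  move=> [i z0] /=; have [iz0|] := pselect (ccover L i z0).
    by have [B [r ?]] := local_root iz0; exists (B, r).
  by exists (set0, fun=> 0).
have /choice[dlog hdlog] : forall w : C, exists x : 'Z_k, w ^+ k = 1 -> w = chi x.
  move=> w; have [/(chi_surj hk)[x wx]|?] := pselect (w ^+ k = 1).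
    by exists x.
  by exists 0.
pose cov (j : cix L * C2) : set C2 := [set z | ccover L j.1 j.2 /\ (br j).1 z].
pose ratio (j j' : cix L * C2) z := cval L j.1 j'.1 z * (br j').2 z / (br j).2 z.
pose n : cech1 C2 'Z_k := Cech1 cov (fun j j' z => dlog (ratio j j' z)).
have covL j z : cov j z -> ccover L j.1 z.
  by move=> [jj jz]; have [_ _ + _] := hbr _ jj; apply.
have brk j z : cov j z -> (br j).2 z ^+ k * h j.1 z = 1.
  by move=> [jj jz]; have [_ _ _ /(_ z jz)[]] := hbr _ jj.
have brd j z : cov j z -> differentiable ((br j).2 : C2 -> C^o) z.
  by move=> [jj jz]; have [_ _ _ /(_ z jz)[]] := hbr _ jj.
have brn0 j z : cov j z -> (br j).2 z != 0.
  move=> jz; apply/eqP => e; have := brk _ _ jz.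
  by rewrite e expr0n eqn0Ngt k0 mul0r => /esym/eqP; rewrite oner_eq0.
have brkE j z : cov j z -> (br j).2 z ^+ k = (h j.1 z)^-1.
  move=> jz; have hz : h j.1 z != 0 by apply/hn0/covL.
  by apply: (mulIf hz); rewrite brk// mulVf.
have ratio_k j j' z : cov j z -> cov j' z -> ratio j j' z ^+ k = 1.
  move=> jz j'z; rewrite /ratio exprMn exprVn exprMn !brkE// invrK.
  rewrite mulrAC (mulrC (_ ^+ k)) hg; [|exact: covL|exact: covL].
  by rewrite divff// hn0//; exact: covL.
have chi_n j j' z : cov j z -> cov j' z -> chi (dlog (ratio j j' z)) = ratio j j' z.
  by move=> jz j'z; rewrite -hdlog//; exact: ratio_k.
have own i z : ccover L i z -> cov (i, z) z.
  by move=> iz; split=> //; have [] := hbr (i, z) iz.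
have cov_open j : open (cov j).
  have [jj|njj] := pselect (ccover L j.1 j.2).
    have [oB _ _ _] := hbr _ jj.
    by rewrite (_ : cov j = (br j).1)//; apply/seteqP; split=> z // [].
  by rewrite (_ : cov j = set0); [exact: open0|apply/seteqP; split=> z // []].
have nY : local_system Y n.
  split=> /=.
  - exact: cov_open.
  - apply/seteqP; split=> [z [j _ /covL/LY]//|z Yz].
    by have [i iz] := Lcov Yz; exists (i, z) => //; exact: own.
  - move=> j j' z [jz j'z].
    have rc : {for z, continuous (ratio j j')}.
      apply: (@differentiable_continuous _ C2 C^o).
      apply: (@differentiableM _ _ (fun z => cval L j.1 j'.1 z * (br j').2 z)
        (fun z => ((br j).2 z)^-1)).
        by apply: differentiableM; [apply: gd; exact: covL|exact: brd].
      by apply: differentiableV; [exact: brd|exact: brn0].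
    have rn0 : ratio j j' z != 0.
      by rewrite -chi_n// chi_neq0.
    have nj : \forall w \near z, cov j w by apply: open_nbhs_nbhs.
    have nj' : \forall w \near z, cov j' w by apply: open_nbhs_nbhs.
    have : \forall w \near z, ratio j j' w = ratio j j' z.
      apply: (locconst_root k0 rn0 rc).
      by apply: filterS2 nj nj' => w ? ?; rewrite !ratio_k.
    by apply: filterS => w ->.
  - move=> j1 j2 j3 z z1 z2 z3; apply: (@chi_inj R k hk).
    rewrite chiD// (chi_n j1 j2 z)// (chi_n j2 j3 z)// (chi_n j1 j3 z)//.
    have [_ _ _ Lc] := hL.
    rewrite /ratio -(Lc j1.1 j2.1 j3.1 z); [|exact: covL..].
    have := brn0 _ _ z1; have := brn0 _ _ z2.
    move: (cval L _ _ z) (cval L _ _ z) ((br j1).2 z) ((br j2).2 z) ((br j3).2 z).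
    by move=> g1 g2 r1 r2 r3 r20 r10; field; rewrite r20 r10.
have [l [s [sl sc]]] := multiple_of_generator Yth YD ha nY.
exists l.
have [[ao aD al ac] _] := ha.
have app p z : ccover a p z -> cval a p p z = 0.
  by move=> pz; apply: (addrI (cval a p p z)); rewrite ac// addr0.
(* The isomorphism in the rescaled frame j; v_same shows that it does not
   depend on which local root for the trivialization j.1 is used. *)
pose v p j z := (br j).2 z * chi (s j p z).
have vE p q j j' z : cov j z -> cov j' z -> ccover a p z -> ccover a q z ->
    v p j z * chi (l *~ cval a p q z) = cval L j.1 j'.1 z * v q j' z.
  move=> jz j'z pz qz; have Yz := LY (covL _ _ jz).
  rewrite /v -mulrA -chiD// -(sc j j' p q z Yz jz j'z pz qz) chiD//= chi_n//.
  rewrite /ratio; have := brn0 _ _ jz.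
  move: (cval L _ _ z) ((br j).2 z) ((br j').2 z) (chi _) => g r1 r2 e r10.
  by field.
have v_same p j j' z : j.1 = j'.1 -> cov j z -> cov j' z -> ccover a p z ->
    v p j z = v p j' z.
  move=> jj' jz j'z pz; have := vE p p j j' z jz j'z pz pz.
  rewrite app// mulr0z chi0 mulr1 => ->.
  by rewrite -jj' (line_bundle_diag hL) ?mul1r//; exact: covL.
(* Among the roots for i, the one taken around z itself is defined at z. *)
exists (fun p i z => v p (i, z) z); split.
- move=> p i; split=> [|z [[Yz pz] iz]]; last first.
    by rewrite mulf_neq0 ?chi_neq0// brn0//; exact: own.
  apply/std_holomorphicP => z [[Yz pz] iz].
  have iz' := own _ _ iz.
  have dv : differentiable ((fun w => (br (i, z)).2 w * chi (s (i, z) p z))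
      : C2 -> C^o) z.
    apply: differentiableM; first exact: brd.
    exact: differentiable_cst.
  apply: near_eq_differentiable dv.
  have oi : \forall w \near z, cov (i, z) w.
    by apply: (@open_nbhs_nbhs _ _ (cov (i, z))); split.
  have nL : \forall w \near z, ccover L i w by apply: open_nbhs_nbhs.
  have nA : \forall w \near z, ccover a p w by apply: open_nbhs_nbhs.
  have ns := sl (i, z) p z Yz iz' pz.
  near=> w.
  rewrite (v_same p (i, w) (i, z))//; last 3 first.
  - by apply: own; near: w.
  - by near: w.
  - by near: w.
  by rewrite /v (near ns w).
- move=> p q i j z [Yz pz] [_ qz] iz jz.
  rewrite [cval _ _ _ _](_ : _ = chi (l *~ cval a p q z)); last exact: F_bundle_transition.
  by rewrite (vE p q (i, z) (j, z))//; exact: own.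
Unshelve. all: by end_near. Qed.

(** For [l = 0] the model bundle has transition functions [1], so the isomorphism
with [L] does not depend on its first index. *)
Lemma trivial_bundle_section : bundle_iso std (cech_restrict Y (F_bundle k 0 a)) L ->
  exists u : cix L -> C2 -> C, (forall i, holomorphic_unit std (ccover L i) (u i)) /\
    forall i j z, ccover L i z -> ccover L j z -> u i z = cval L i j z * u j z.
Proof.
move=> [v [vu vc]].
have [[ao aD al ac] _] := ha.
have /choice[ix hix] : forall z, exists p : option (cix a),
    Y z -> exists2 q, p = Some q & ccover a q z.
  move=> z; have [Yz|] := pselect (Y z); last by exists None.
  by have := YD Yz; rewrite -aD => -[p _ pz]; exists (Some p) => _; exists p.
have E p q z : cval (cech_restrict Y (F_bundle k 0 a)) p q z = 1.
  by rewrite /= mul0r mul0r mulr0 cexp0.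
have same p q i z : ccover a p z -> ccover a q z -> ccover L i z -> v p i z = v q i z.
  move=> pz qz iz; have Yz := LY iz.
  have := vc p q i i z (conj Yz pz) (conj Yz qz) iz iz.
  by rewrite E mulr1 (line_bundle_diag hL)// mul1r.
pose u i z := if ix z is Some p then v p i z else 0.
have uE p i z : ccover a p z -> ccover L i z -> u i z = v p i z.
  move=> pz iz; rewrite /u; have [q -> qz] := hix z (LY iz).
  exact: same.
exists u; split=> [i|i j z iz jz].
  split=> [|z iz]; last first.
    have [p _ pz] := hix z (LY iz); rewrite (uE p)//.
    by have [_] := vu p i; apply; split=> //; split=> //; exact: LY iz.
  apply/std_holomorphicP => z iz; have Yz := LY iz.
  have [p _ pz] := hix z Yz.
  have [/std_holomorphicP /(_ z) dv _] := vu p i.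
  apply: near_eq_differentiable (dv _); last by split.
  have nL : \forall w \near z, ccover L i w by apply: open_nbhs_nbhs.
  have nA : \forall w \near z, ccover a p w by apply: open_nbhs_nbhs.
  by apply: filterS2 nL nA => w iw pw; rewrite (uE p).
have Yz := LY iz; have [p _ pz] := hix z Yz.
rewrite !(uE p)//; have := vc p p i j z (conj Yz pz) (conj Yz pz) iz jz.
by rewrite E mulr1.
Qed.

End Torsion.

(** * Second derivatives along planes *)

Section OneVariable.
Context {R : realType}.
Variables (f f1 f2 : R -> R).
Hypothesis df : forall t : R, 0 <= t <= 1 -> is_derive t (1 : R) f (f1 t).
Hypothesis df1 : forall t : R, 0 <= t <= 1 -> is_derive t (1 : R) f1 (f2 t).

Lemma mean_value (g dg : R -> R) (a b : R) :
  (forall t : R, 0 <= t <= 1 -> is_derive t (1 : R) g (dg t)) ->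
  0 <= a -> a < b -> b <= 1 ->
  exists c, [/\ a < c, c < b & g b - g a = dg c * (b - a)].
Proof.
move=> dg' a0 ab b1.
have h t : a <= t <= b -> 0 <= t <= 1.
  by move=> /andP[? ?]; apply/andP; split; lra.
have [x|x|c] := @MVT R g dg a b ab.
- by rewrite in_itv /= => /andP[/ltW ? /ltW ?]; apply/dg'/h/andP.
- apply: continuous_in_subspaceT => t; rewrite inE /= in_itv /= => /h /dg' gt.
  by apply: differentiable_continuous; apply/derivable1_diffP; case: gt.
by rewrite in_itv /= => /andP[? ?] ?; exists c.
Qed.

(** Apply the mean value theorem to [f] and then to [f1]. *)
Lemma convex_critical_lt : f1 0 = 0 ->
  (forall t : R, 0 <= t <= 1 -> 0 < f2 t) -> f 0 < f 1.
Proof.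
move=> c0 f2p.
have [c [c1 c2 e1]] := mean_value df (lexx 0) ltr01 (lexx 1).
have [d [d1 d2 e2]] := mean_value df1 (lexx 0) c1 (ltW c2).
have : 0 < f2 d by apply: f2p; apply/andP; split; lra.
rewrite -[f 0 < f 1]subr_gt0 e1 subr0 mulr1; move: e2; rewrite c0 !subr0 => -> h.
by rewrite mulr_gt0.
Qed.

(** If [f s <= m], then [f] decreases somewhere before [s] and increases somewhere
after, which contradicts the decrease of [f1]. *)
Lemma concave_gt (s m : R) : (forall t : R, 0 <= t <= 1 -> f2 t < 0) ->
  0 <= s <= 1 -> m < f 0 -> m < f 1 -> m < f s.
Proof.
move=> f2n /andP[s0 s1] m0 m1; rewrite ltNge; apply/negP => fs.
have sn0 : 0 < s.
  by rewrite lt_neqAle s0 andbT; apply/negP => /eqP e; move: m0; rewrite e; lra.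
have sn1 : s < 1.
  by rewrite lt_neqAle s1 andbT; apply/negP => /eqP e; move: m1; rewrite -e; lra.
have [c [c1 c2 e1]] := mean_value df (lexx 0) sn0 s1.
have [d [d1 d2 e2]] := mean_value df s0 sn1 (lexx 1).
have c0 : 0 <= c by lra.
have cd : c < d by lra.
have dl1 : d <= 1 by lra.
have [e [e3 e4 e5]] := mean_value df1 c0 cd dl1.
have fe : f2 e < 0 by apply: f2n; apply/andP; split; lra.
have h1 : f1 c < 0 by nra.
have h2 : 0 < f1 d by nra.
by nra.
Qed.

End OneVariable.

Section BinaryForm.
Context {R : realType} {T : topologicalType}.

(** A binary quadratic form is positive definite when its first coefficient and
[4 a d - b ^+ 2] are positive, and these are open conditions. *)
Lemma binary_form_near (p : T) (a b d : T -> R) :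
  {for p, continuous a} -> {for p, continuous b} -> {for p, continuous d} ->
  (forall s t : R, (s != 0) || (t != 0) ->
     0 < s ^+ 2 * a p + s * t * b p + t ^+ 2 * d p) ->
  \forall q \near p, forall s t : R, (s != 0) || (t != 0) ->
     0 < s ^+ 2 * a q + s * t * b q + t ^+ 2 * d q.
Proof.
move=> ac bc dc pos.
have ap : 0 < a p by have := pos 1 0; rewrite oner_eq0 => /(_ isT); nra.
have disc : 0 < 4 * a p * d p - b p * b p.
  have nz : 2 * a p != 0 by rewrite gt_eqF// mulr_gt0.
  (* For this t the form is minimal at this s, and its value there is
     a p * (4 * a p * d p - b p * b p). *)
  have := pos (- b p) (2 * a p); rewrite nz orbT => /(_ isT).
  have -> : (- b p) ^+ 2 * a p + - b p * (2 * a p) * b p + (2 * a p) ^+ 2 * d p =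
    a p * (4 * a p * d p - b p * b p) by ring.
  by rewrite pmulr_rgt0.
have discc : {for p, continuous (fun q => 4 * a q * d q - b q * b q)}.
  apply: (@continuousB _ R^o _ (fun q => 4 * a q * d q) (fun q => b q * b q)).
    apply: (@continuousM _ _ (fun q => 4 * a q) d) => //.
    by apply: (@continuousM _ _ (cst 4) a) => //; exact: cst_continuous.
  exact: (@continuousM _ _ b b).
have np (g : T -> R) : {for p, continuous g} -> 0 < g p -> \forall q \near p, 0 < g q.
  move=> gc gp; apply: (gc [set r | 0 < r]).
  by apply: open_nbhs_nbhs; split=> //; exact: open_gt.
apply: filterS2 (np _ ac ap) (np _ discc disc) => q; move: (a q) (b q) (d q).
move=> a' b' d' a'0 disc' s t.
have key : 4 * a' * (s ^+ 2 * a' + s * t * b' + t ^+ 2 * d') =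
  (2 * a' * s + b' * t) ^+ 2 + t ^+ 2 * (4 * a' * d' - b' * b') by ring.
move=> st; have a4 : 0 < 4 * a' by rewrite mulr_gt0.
rewrite -(pmulr_rgt0 _ a4) key.
have [t0|tn0] := eqVneq t 0.
  rewrite t0 eqxx orbF in st; rewrite t0 mulr0 addr0 expr0n mul0r addr0.
  by rewrite exprn_even_gt0//= mulf_neq0// gt_eqF// mulr_gt0.
rewrite ltr_wpDl ?sqr_ge0//; apply: mulr_gt0 => //.
by rewrite exprn_even_gt0.
Qed.

End BinaryForm.

Section SecondDerivative.
Context {R : realType} {N : nat}.
Local Notation V := 'rV[R]_N.
Variable f : V -> R^o.

Lemma derive_dir_lin (g : V -> R^o) x (s t : R) (u v : V) : differentiable g x ->
  'D_(s *: u + t *: v) g x = s * 'D_u g x + t * 'D_v g x.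
Proof. by move=> dg; rewrite !deriveE// linearD !linearZ. Qed.

(** Differentiability on a neighborhood of [q] makes the directional derivative
linear in the direction near [q], and this relation can be differentiated
again. *)
Definition twice_diff (q : V) :=
  (\forall x \near q, differentiable f x) /\ forall u, differentiable ('D_u f) q.

Lemma derive2_lin q (u : V) (s t : R) (v w : V) : twice_diff q ->
  'D_u ('D_(s *: v + t *: w) f) q = s * 'D_u ('D_v f) q + t * 'D_u ('D_w f) q.
Proof.
move=> [nf df].
have dd x : derivable ('D_x f) q u by apply: diff_derivable; exact: df.
rewrite -(@near_eq_derive _ _ _ (s *: 'D_v f + t *: 'D_w f)); last first.
  by apply: filterS nf => x dfx; rewrite derive_dir_lin.
rewrite deriveD; [|exact: derivableZ|exact: derivableZ].
by rewrite !deriveZ.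
Qed.

Lemma derive2_sum q (u : V) n (c : 'I_n -> R) (v : 'I_n -> V) : twice_diff q ->
  'D_u ('D_(\sum_i c i *: v i) f) q = \sum_i c i * 'D_u ('D_(v i) f) q.
Proof.
move=> tq; elim: n c v => [|n IH] c v; last first.
  rewrite !big_ord_recr /= -IH -[X in 'D_(X + _) f]scale1r derive2_lin//.
  by rewrite mul1r.
rewrite !big_ord0.
by rewrite -(addr0 0) -[X in 'D_(X + _) f](scale0r 0) -[X in 'D_(_ + X) f](scale0r 0)
  derive2_lin// !mul0r addr0.
Qed.

Lemma derive_sum_dir (g : V -> R^o) q n (c : 'I_n -> R) (v : 'I_n -> V) :
  differentiable g q -> 'D_(\sum_i c i *: v i) g q = \sum_i c i * 'D_(v i) g q.
Proof.
move=> dg; rewrite deriveE// linear_sum; apply: eq_bigr => i _.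
by rewrite linearZ -deriveE.
Qed.

Lemma hessian_form q (v : V) : twice_diff q ->
  (v *m hessian f q *m v^T) 0 0 = 'D_v ('D_v f) q.
Proof.
move=> tq; have [_ df] := tq.
pose e (j : 'I_N) : V := delta_mx 0 j.
have vE : v = \sum_j v 0 j *: e j by exact: row_sum_delta.
have -> : 'D_v ('D_v f) q = \sum_b v 0 b * \sum_j v 0 j * 'D_(e j) ('D_(e b) f) q.
  transitivity ('D_v ('D_(\sum_j v 0 j *: e j) f) q); first by rewrite -vE.
  rewrite derive2_sum//; apply: eq_bigr => b _; congr (_ * _).
  by rewrite {1}vE derive_sum_dir//; exact: df.
rewrite mxE; apply: eq_bigr => b _; rewrite !mxE mulrC; congr (_ * _).
by apply: eq_bigr => j _; rewrite mxE.
Qed.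

Variable B : 'M[R]_(2, N).

Lemma mulmx2 (y : 'rV[R]_2) : y *m B = y 0 0 *: row 0 B + y 0 1 *: row 1 B.
Proof.
have e0 : ord0 = 0 :> 'I_2 by [].
have e1 : lift ord0 ord0 = 1 :> 'I_2 by apply: ord_inj.
by rewrite mulmx_sum_row big_ord_recl big_ord1 e1 e0.
Qed.

Let M (i j : 'I_2) (q : V) : R := 'D_(row i B) ('D_(row j B) f) q.

Lemma derive2_plane q (y : 'rV[R]_2) : twice_diff q ->
  'D_(y *m B) ('D_(y *m B) f) q =
  y 0 0 ^+ 2 * M 0 0 q + y 0 0 * y 0 1 * (M 0 1 q + M 1 0 q) + y 0 1 ^+ 2 * M 1 1 q.
Proof.
move=> tq; have [_ df] := tq.
rewrite mulmx2 (derive2_lin _ _ _ _ _ tq).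
rewrite (derive_dir_lin _ _ _ _ (df (row 0 B))) (derive_dir_lin _ _ _ _ (df (row 1 B))).
rewrite -/(M 0 0 q) -/(M 0 1 q) -/(M 1 0 q) -/(M 1 1 q).
move: (y 0 0) (y 0 1) (M 0 0 q) (M 0 1 q) (M 1 0 q) (M 1 1 q) => s t m1 m2 m3 m4.
by ring.
Qed.

(** The sign [c] allows for both positive and negative definite planes. *)
Lemma definite_near (p : V) (c : R) :
  twice_diff p -> (\forall q \near p, twice_diff q) ->
  (forall i j, {for p, continuous (M i j)}) ->
  (forall y : 'rV[R]_2, y != 0 ->
    0 < c * ((y *m B) *m hessian f p *m (y *m B)^T) 0 0) ->
  \forall q \near p, forall y : 'rV[R]_2, y != 0 ->
    0 < c * 'D_(y *m B) ('D_(y *m B) f) q.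
Proof.
move=> tp ntw Mc pos.
pose a q := c * M 0 0 q.
pose b q := c * (M 0 1 q + M 1 0 q).
pose d q := c * M 1 1 q.
have formE q y : twice_diff q -> c * 'D_(y *m B) ('D_(y *m B) f) q =
    y 0 0 ^+ 2 * a q + y 0 0 * y 0 1 * b q + y 0 1 ^+ 2 * d q.
  move=> tq; rewrite (derive2_plane y tq) /a /b /d.
  move: (y 0 0) (y 0 1) (M 0 0 q) (M 0 1 q) (M 1 0 q) (M 1 1 q) => *; ring.
pose mk (s t : R) : 'rV[R]_2 := \row_j if j == 0 then s else t.
have mk0 s t : mk s t 0 0 = s by rewrite mxE.
have mk1 s t : mk s t 0 1 = t by rewrite mxE.
have pos' s t : (s != 0) || (t != 0) -> 0 < s ^+ 2 * a p + s * t * b p + t ^+ 2 * d p.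
  move=> st; have mkn0 : mk s t != 0.
    apply: contraTneq st => e.
    have s0 : s = 0 by rewrite -[LHS](mk0 s t) e mxE.
    have t0 : t = 0 by rewrite -[LHS](mk1 s t) e mxE.
    by rewrite s0 t0 eqxx.
  by have := pos _ mkn0; rewrite (hessian_form _ tp) (formE _ _ tp) mk0 mk1.
have ac : {for p, continuous a}.
  by apply: (@continuousM _ _ (cst c) (M 0 0)); [exact: cst_continuous|exact: Mc].
have bc : {for p, continuous b}.
  apply: (@continuousM _ _ (cst c) (fun q => M 0 1 q + M 1 0 q)).
    exact: cst_continuous.
  by apply: (@continuousD _ R^o _ (M 0 1) (M 1 0)); exact: Mc.
have dc : {for p, continuous d}.
  by apply: (@continuousM _ _ (cst c) (M 1 1)); [exact: cst_continuous|exact: Mc].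
have := binary_form_near ac bc dc pos'.
apply: filterS2 ntw => q tq form y y0; rewrite (formE _ _ tq); apply: form.
apply: contraNT y0; rewrite negb_or !negbK => /andP[/eqP y00 /eqP y01].
apply/eqP/rowP => j; rewrite mxE.
by have [->|->] : j = 0 \/ j = 1 by case: j => -[|[|//]] ?; [left|right]; apply/val_inj.
Qed.

Lemma line_derive (g : V -> R^o) (q v : V) (t : R) :
  differentiable g (q + t *: v) ->
  is_derive t (1 : R) (fun t : R => g (q + t *: v)) ('D_v g (q + t *: v)).
Proof.
move=> dg; have dv : derivable g (q + t *: v) v by exact: diff_derivable.
have E : (fun h : R => h^-1 *: (((fun t : R => g (q + t *: v)) \o shift t) (h *: (1 : R)) -
    g (q + t *: v))) =
  (fun h : R => h^-1 *: ((g \o shift (q + t *: v)) (h *: v) - g (q + t *: v))).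
  apply/funext => h /=; congr (_ *: (g _ - _)).
  by rewrite [h *: 1]mulr1 scalerDl addrCA.
by split; rewrite /derivable /derive E.
Qed.

End SecondDerivative.

(** * The Levi form and a totally real negative plane *)

Section RealStructure.
Context {R : realType} {n : nat}.
Local Notation C := R[i].
Implicit Types (u v : 'rV[R]_(n + n)) (H : 'M[R]_(n + n)).

(** Multiplication by [i] in real coordinates. *)
Definition Jmx : 'M[R]_(n + n) := block_mx 0 1%:M (- 1%:M) 0.

Definition quad H v : R := (v *m H *m v^T) 0 0.

Lemma quadN H v : quad H (- v) = quad H v.
Proof. by rewrite /quad linearN /= mulNmx mulmxN mulNmx opprK. Qed.

Lemma mulJ_l v j : (v *m Jmx) 0 (lshift n j) = - v 0 (rshift n j).
Proof.
rewrite -[v in v *m _]hsubmxK mul_row_block !mulmx0 add0r addr0 mulmx1 mulmxN mulmx1.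
by rewrite row_mxEl !mxE.
Qed.

Lemma mulJ_r v j : (v *m Jmx) 0 (rshift n j) = v 0 (lshift n j).
Proof.
rewrite -[v in v *m _]hsubmxK mul_row_block !mulmx0 add0r addr0 mulmx1 mulmxN mulmx1.
by rewrite row_mxEr !mxE.
Qed.

Lemma JmxJ v : v *m Jmx *m Jmx = - v.
Proof.
apply/rowP => j; rewrite [RHS]mxE; case: (split_ordP j) => i ->.
  by rewrite mulJ_l mulJ_r.
by rewrite mulJ_r mulJ_l.
Qed.

Lemma of_realE v j : of_real v 0 j = Complex (v 0 (lshift n j)) (v 0 (rshift n j)).
Proof. by rewrite mxE. Qed.

Lemma of_realD u v : of_real (u + v) = of_real u + of_real v.
Proof. by apply/rowP => j; rewrite !mxE. Qed.

Lemma of_realZ (r : R) v : of_real (r *: v) = (r%:C)%C *: of_real v.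
Proof.
apply/rowP => j; rewrite !mxE; apply/eqP; rewrite eq_complex /=.
by rewrite !mul0r subr0 addr0 !eqxx.
Qed.

Lemma of_realN v : of_real (- v) = - of_real v.
Proof. by apply/rowP => j; rewrite !mxE. Qed.

Lemma of_realJ v : of_real (v *m Jmx) = 'i%C *: of_real v.
Proof.
apply/rowP => j; rewrite [RHS]mxE !of_realE mulJ_l mulJ_r.
by apply/eqP; rewrite eq_complex /=; apply/andP; split; apply/eqP; ring.
Qed.

Lemma to_realK (z : 'rV[C]_n) : of_real (to_real z) = z.
Proof.
apply/rowP => j; rewrite of_realE /to_real row_mxEl row_mxEr !mxE.
by case: (z 0 j).
Qed.

Lemma of_realK v : to_real (of_real v) = v.
Proof.
by rewrite -[RHS]hsubmxK; congr row_mx; apply/rowP => j; rewrite !mxE.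
Qed.

Lemma of_real_eq0 v : (of_real v == 0) = (v == 0).
Proof.
apply/eqP/eqP => [e|->]; last by apply/rowP => j; rewrite !mxE.
rewrite -(of_realK v) e -[RHS]hsubmxK; congr row_mx; apply/rowP => j; rewrite !mxE//.
Qed.

Lemma quad_split H v : quad H v = \sum_j \sum_k
  (v 0 (lshift n j) * H (lshift n j) (lshift n k) * v 0 (lshift n k)
 + v 0 (lshift n j) * H (lshift n j) (rshift n k) * v 0 (rshift n k)
 + v 0 (rshift n j) * H (rshift n j) (lshift n k) * v 0 (lshift n k)
 + v 0 (rshift n j) * H (rshift n j) (rshift n k) * v 0 (rshift n k)).
Proof.
have E : quad H v = \sum_a \sum_b v 0 a * H a b * v 0 b.
  rewrite /quad mxE exchange_big /=; apply: eq_bigr => b _.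
  by rewrite !mxE mulr_suml.
rewrite E big_split_ord /= -big_split /=; apply: eq_bigr => j _.
rewrite !big_split_ord /= -!big_split /=; apply: eq_bigr => k _.
by rewrite !addrA.
Qed.

(** The Levi form is the part of the Hessian that is invariant under [Jmx]. *)
Lemma levi_quad H v :
  quad H v + quad H (v *m Jmx) = 4 * complex.Re (\sum_j \sum_k
    levi_matrix H j k * of_real v 0 j * (of_real v 0 k)^*).
Proof.
rewrite !quad_split -big_split /= raddf_sum mulr_sumr; apply: eq_bigr => j _.
rewrite -big_split /= raddf_sum mulr_sumr; apply: eq_bigr => k _.
rewrite !mulJ_l !mulJ_r !of_realE mxE.
have -> : (4%:R^-1 : C) = ((4^-1 : R)%:C)%C by rewrite fmorphV rmorph_nat.
have cE (a b : R) : (Complex a b : C)^* = Complex a (- b) by [].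
rewrite cE; move: (v 0 _) (v 0 _) (v 0 _) (v 0 _) => a1 b1 a2 b2.
move: (H _ _) (H _ _) (H _ _) (H _ _) => h1 h2 h3 h4 /=.
by field.
Qed.

Lemma positive_levi_quad H v : positive_definite_form (levi_matrix H) ->
  v != 0 -> 0 < quad H v + quad H (v *m Jmx).
Proof.
move=> Hp v0; rewrite levi_quad; apply: mulr_gt0 => //.
have := Hp (of_real v); rewrite of_real_eq0 v0 => /(_ isT).
by rewrite ltcE => /andP[].
Qed.

End RealStructure.

Section Planes.
Context {R : realType}.
Local Notation C := R[i].
Variable H : 'M[R]_(2 + 2).
Hypothesis Hlevi : positive_definite_form (levi_matrix H).

(** On the image by [Jmx] of the negative plane, [positive_levi_quad] leaves only
positive values. *)
Lemma negative_plane : negative_index H 2 ->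
  exists B : 'M[R]_(2, 2 + 2),
    (forall y : 'rV[R]_2, y != 0 -> quad H (y *m B) < 0) /\
    (forall y : 'rV[R]_2, y != 0 -> 0 < quad H (y *m B *m Jmx)).
Proof.
move=> [[W rW nW] _].
have [B Bf BW] : exists2 B : 'M[R]_(2, 2 + 2), row_free B & (B <= W)%MS.
  have gen r : \rank W = r -> exists2 B : 'M[R]_(r, 2 + 2), row_free B & (B <= W)%MS.
    by move=> <-; exists (row_base W); [exact: row_base_free | rewrite eq_row_base].
  exact: gen.
have y0 (y : 'rV[R]_2) : y != 0 -> y *m B != 0.
  by apply: contraNneq => e; apply/eqP/(row_free_inj Bf); rewrite e mul0mx.
have neg (y : 'rV[R]_2) : y != 0 -> quad H (y *m B) < 0.
  by move=> yn; apply: nW; [exact: mulmx_sub | exact: y0].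
exists B; split=> // y yn.
by have := positive_levi_quad Hlevi (y0 _ yn); have := neg _ yn; lra.
Qed.

Variable B : 'M[R]_(2, 2 + 2).
Hypothesis Bneg : forall y : 'rV[R]_2, y != 0 -> quad H (y *m B) < 0.
Hypothesis Bpos : forall y : 'rV[R]_2, y != 0 -> 0 < quad H (y *m B *m Jmx).

(** The rows are [- i w] for the rows [w] of [B], so that the plane of [B] is
spanned by the imaginary axes of the new coordinates. *)
Definition frame : 'M[C]_2 := \matrix_(j, k) (- 'i%C * of_real (row j B) 0 k).

Definition rowRe (z : 'rV[C]_2) : 'rV[R]_2 := \row_j complex.Re (z 0 j).
Definition rowIm (z : 'rV[C]_2) : 'rV[R]_2 := \row_j complex.Im (z 0 j).

Lemma of_real_mul (y : 'rV[R]_2) k :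
  of_real (y *m B) 0 k = \sum_j ((y 0 j)%:C)%C * of_real (row j B) 0 k.
Proof.
have -> : of_real (y *m B) = \sum_j ((y 0 j)%:C)%C *: of_real (row j B).
  rewrite mulmx_sum_row (big_morph _ (@of_realD R 2) (id1 := 0)).
    by apply: eq_bigr => j _; rewrite of_realZ.
  by apply/eqP; rewrite of_real_eq0.
by rewrite summxE; apply: eq_bigr => j _; rewrite mxE.
Qed.

Lemma frameE z :
  z *m frame = of_real (rowIm z *m B - rowRe z *m B *m Jmx).
Proof.
apply/rowP => k; rewrite of_realD of_realN of_realJ mxE [RHS]mxE [X in _ + X]mxE.
rewrite [X in _ - X]mxE !of_real_mul mulr_sumr -sumrB; apply: eq_bigr => j _.
rewrite !mxE; case: (z 0 j) => x y /=.
by apply/eqP; rewrite eq_complex /=; apply/andP; split; apply/eqP; ring.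
Qed.

(** A vector of both the plane of [B] and its image by [Jmx] vanishes, as the
quadratic form has opposite signs on the two planes. *)
Lemma frame_unit : frame \in unitmx.
Proof.
rewrite -row_free_unit; apply: inj_row_free => z.
rewrite frameE => /eqP; rewrite of_real_eq0 subr_eq0 => /eqP e.
have x0 : rowRe z = 0.
  apply/eqP; apply: contraT => /[dup] xn /Bpos; rewrite -e.
  have [->|/Bneg yn] := eqVneq (rowIm z) 0.
    by rewrite mul0mx /quad !mul0mx mxE ltxx.
  by move=> /(lt_trans yn); rewrite ltxx.
have y0 : rowIm z = 0.
  apply/eqP; apply: contraT => /Bneg.
  by rewrite e x0 !mul0mx /quad !mul0mx mxE ltxx.
apply/rowP => j; have := congr1 (fun v : 'rV_2 => v 0 j) x0.
have := congr1 (fun v : 'rV_2 => v 0 j) y0; rewrite !mxE.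
by case: (z 0 j) => x y /= -> ->.
Qed.

End Planes.

(** * Affine changes of chart and pullbacks of holomorphic functions *)

Section Affine.
Context {K : numFieldType} {m n : nat}.

Lemma continuous_mulmxr (T : 'M[K]_(m, n)) :
  continuous (fun w : 'rV[K]_m => w *m T).
Proof.
have -> : (fun w : 'rV[K]_m => w *m T) =
    fun w => \row_j \sum_k w 0 k * T k j.
  by apply/funext => w; apply/rowP => j; rewrite !mxE.
move=> v.
apply: (@continuous_row K n _ (fun j (w : 'rV[K]_m) => \sum_k w 0 k * T k j)) => j.
have -> : (fun w : 'rV[K]_m => \sum_k w 0 k * T k j) =
    \sum_k (fun w : 'rV[K]_m => w 0 k * T k j : K^o).
  by apply/funext => w; rewrite fct_sumE.
apply: differentiable_continuous; apply: differentiable_sum => k.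
apply: differentiableM; last exact: differentiable_cst.
exact: differentiable_coord.
Qed.

Lemma differentiable_mulmxr (T : 'M[K]_(m, n)) (v : 'rV[K]_m) :
  differentiable (fun w : 'rV[K]_m => w *m T) v.
Proof.
exact: (@linear_differentiable K _ _ (mulmxr T) v (@continuous_mulmxr T)).
Qed.

Lemma differentiable_affine (T : 'M[K]_(m, n)) (b : 'rV[K]_n) (v : 'rV[K]_m) :
  differentiable (fun w : 'rV[K]_m => b + w *m T) v.
Proof.
by apply: differentiableD; [exact: differentiable_cst | exact: differentiable_mulmxr].
Qed.

Lemma differentiable_affineV (T : 'M[K]_(m, n)) (b : 'rV[K]_m) (v : 'rV[K]_m) :
  differentiable (fun w : 'rV[K]_m => (w - b) *m T) v.
Proof.
have -> : (fun w : 'rV[K]_m => (w - b) *m T) = fun w => - (b *m T) + w *m T.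
  by apply/funext => w; rewrite mulmxBl addrC.
exact: differentiable_affine.
Qed.

End Affine.

Section Charts.
Context {R : realType} {n : nat} {X : topologicalType}.
Local Notation C := R[i].
Variable A : set (chart R n X).
Hypothesis hA : is_atlas A.

Lemma chart_cmapK (phi : chart R n X) x :
  is_chart phi -> cdom phi x -> cinv phi (cmap phi x) = x.
Proof. by case=> _ _ _ _ K dx; apply: K; exact: mem_set. Qed.

Lemma chart_cinvK (phi : chart R n X) z :
  is_chart phi -> ccodom phi z -> cdom phi (cinv phi z) /\ cmap phi (cinv phi z) = z.
Proof. by move=> hphi [x dx <-]; rewrite chart_cmapK. Qed.

Lemma holomorphic_pullback (phi : chart R n X) (W : set X) (f : X -> C) x :
  is_biholomorphism A phi -> holomorphic A W f -> W x -> cdom phi x ->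
  differentiable (f \o cinv phi : 'rV[C]_n -> C^o) (cmap phi x).
Proof.
move=> [hphi tr] hf Wx dx; have [Ac _ Acov] := hA.
have [psi Apsi psix] := Acov x; have [tr1 _] := tr _ Apsi.
have [opsi _ _ _ _] := Ac _ Apsi; have [_ oc _ ic _] := hphi.
have xK := chart_cmapK hphi dx.
have df : differentiable (f \o cinv psi : 'rV[C]_n -> C^o)
    ((cmap psi \o cinv phi) (cmap phi x)) by rewrite /= xK; exact: hf.
apply: near_eq_differentiable (differentiable_comp (tr1 _ dx psix) df).
have cphi : ccodom phi (cmap phi x) by exists x.
have : \forall z \near cmap phi x, cdom psi (cinv phi z).
  apply: (ic _ (mem_set cphi) (cdom psi)); rewrite xK; exact: open_nbhs_nbhs.
by apply: filterS => z dz /=; rewrite (chart_cmapK (Ac _ Apsi)).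
Qed.

Lemma holomorphic_pushforward (phi : chart R n X) (W : set X) (u : 'rV[C]_n -> C) :
  is_biholomorphism A phi -> W `<=` cdom phi ->
  (forall x, W x -> differentiable (u : 'rV[C]_n -> C^o) (cmap phi x)) ->
  holomorphic A W (u \o cmap phi).
Proof.
move=> [hphi tr] Wd du psi x Apsi Wx psix; have [_ tr2] := tr _ Apsi.
have [Ac _ _] := hA.
have xK := chart_cmapK (Ac _ Apsi) psix.
apply: (differentiable_comp (tr2 _ psix (Wd _ Wx))).
by rewrite /= xK; exact: du.
Qed.

Variables (phi0 : chart R n X) (Aphi0 : A phi0).
Variables (T : 'M[C]_n) (b : 'rV[C]_n) (K : set 'rV[C]_n).
Hypothesis Tunit : T \in unitmx.
Hypothesis oK : open K.
Hypothesis Kcodom : forall z, K z -> ccodom phi0 (b + z *m T).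

Definition affine_chart : chart R n X :=
  Chart [set x | cdom phi0 x /\ K ((cmap phi0 x - b) *m invmx T)]
    (fun x => (cmap phi0 x - b) *m invmx T)
    (fun z => cinv phi0 (b + z *m T)).

Let hphi0 : is_chart phi0. Proof. by have [Ac _ _] := hA; exact: Ac. Qed.

Lemma affineK z : (b + z *m T - b) *m invmx T = z.
Proof. by rewrite addrAC subrr add0r mulmxK. Qed.

Lemma affineVK v : b + (v - b) *m invmx T *m T = v.
Proof. by rewrite mulmxKV// addrC subrK. Qed.

Lemma affine_chart_codom : ccodom affine_chart = K.
Proof.
apply/seteqP; split=> [_ [x [_ Kx] <-]//|z Kz].
have [dx mx] := chart_cinvK hphi0 (Kcodom Kz).
exists (cinv phi0 (b + z *m T)) => /=; last by rewrite mx affineK.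
by split=> //; rewrite mx affineK.
Qed.

Lemma affine_chart_is_chart : is_chart affine_chart.
Proof.
have [od oc mc ic mK] := hphi0.
have cm x : cdom phi0 x -> {for x, continuous (cmap affine_chart)}.
  move=> dx; apply: (@continuous_comp _ _ _ (cmap phi0) (fun w => (w - b) *m invmx T)).
    by apply: mc; exact: mem_set.
  by apply: differentiable_continuous; exact: differentiable_affineV.
split.
- rewrite openE => x [dx Kx]; apply: filterI; first exact: open_nbhs_nbhs.
  by apply: (cm x dx); exact: open_nbhs_nbhs.
- by rewrite affine_chart_codom.
- by move=> x /set_mem [dx _]; exact: cm.
- rewrite affine_chart_codom => z /set_mem Kz.
  suff : {for z, continuous (fun z : 'rV[C]_n => cinv phi0 (b + z *m T))} by [].
  apply: (@continuous_comp _ _ _ (fun z : 'rV[C]_n => b + z *m T) (cinv phi0)).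
    by apply: differentiable_continuous; exact: differentiable_affine.
  by apply: ic; apply: mem_set; exact: Kcodom.
- by move=> x /set_mem [dx _] /=; rewrite affineVK chart_cmapK.
Qed.

Lemma affine_chart_biholomorphism : is_biholomorphism A affine_chart.
Proof.
split; first exact: affine_chart_is_chart.
have [Ac tr _] := hA.
move=> psi Apsi; split=> x.
  move=> [dx Kx] psix.
  apply: (@differentiable_comp _ _ _ _ (fun z : 'rV[C]_n => b + z *m T) (cmap psi \o cinv phi0)).
    exact: differentiable_affine.
  by rewrite /= affineVK; exact: tr.
move=> psix [dx Kx].
apply: (@differentiable_comp _ _ _ _ (cmap phi0 \o cinv psi) (fun w => (w - b) *m invmx T)).
  exact: tr.
exact: differentiable_affineV.
Qed.

End Charts.

(** * Functions convex in one plane and concave in another *)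

Section Saddle.
Context {R : realType} {N : nat}.
Local Notation V := 'rV[R]_N.
Variables (f : V -> R^o) (p : V) (Bx By : 'M[R]_(2, N)).

Definition saddle_at (q : V) :=
  [/\ twice_diff f q,
      forall x : 'rV[R]_2, x != 0 -> 0 < 'D_(x *m Bx) ('D_(x *m Bx) f) q &
      forall y : 'rV[R]_2, y != 0 -> 'D_(y *m By) ('D_(y *m By) f) q < 0].

Lemma unit_row_bound (B : 'M[R]_(2, N)) : exists2 b : R, 0 <= b &
  forall x : 'rV[R]_2, (forall j, `|x 0 j| <= 1) -> `|x *m B| <= b.
Proof.
exists (\sum_j `|row j B|); first exact: sumr_ge0.
move=> x x1; rewrite mulmx_sum_row; apply: (le_trans (ler_norm_sum _ _ _)).
by apply: ler_sum => j _; rewrite normrZ ler_piMl.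
Qed.

Definition box_pt (e : R) (x y : 'rV[R]_2) : V := p + (e *: x) *m Bx + (e *: y) *m By.

(** Points of the unit box are mapped to points at a bounded distance from [p],
and [e] scales this bound below the radius of a ball inside [P]. *)
Lemma small_box (P : set V) : nbhs p P -> exists2 e : R, 0 < e &
  forall x y : 'rV[R]_2, (forall j, `|x 0 j| < 1) -> (forall j, `|y 0 j| < 1) -> P (box_pt e x y).
Proof.
move=> /nbhs_ballP[d /= d0 dP].
have [bx bx0 hx] := unit_row_bound Bx; have [b_y by0 hy] := unit_row_bound By.
(* The term 1 only serves to make b positive. *)
pose b := bx + b_y + 1.
have b0 : 0 < b by rewrite ltr_wpDl// addr_ge0.
exists (d / b); first by rewrite divr_gt0.
move=> x y x1 y1; apply: dP; rewrite -ball_normE /= /box_pt.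
rewrite -addrA opprD addrA subrr add0r normrN -!scalemxAl -scalerDr normrZ.
rewrite gtr0_norm ?divr_gt0// mulrAC ltr_pdivrMr// ltr_pM2l//.
apply: (le_lt_trans (ler_normD _ _)).
have hx1 : `|x *m Bx| <= bx by apply: hx => j; exact: ltW.
have hy1 : `|y *m By| <= b_y by apply: hy => j; exact: ltW.
by rewrite /b; lra.
Qed.

Variable e : R.
Hypothesis e0 : 0 < e.
Hypothesis saddle : forall x y : 'rV[R]_2, (forall j, `|x 0 j| < 1) ->
  (forall j, `|y 0 j| < 1) -> saddle_at (box_pt e x y).
Hypothesis crit : forall u, 'D_u f p = 0.

Let e_neq0 (x : 'rV[R]_2) : x != 0 -> e *: x != 0.
Proof. by move=> x0; rewrite scaler_eq0 negb_or gt_eqF. Qed.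

Let scale_lt1 (x : 'rV[R]_2) (t : R) : 0 <= t <= 1 -> (forall j, `|x 0 j| < 1) ->
  forall j, `|(t *: x) 0 j| < 1.
Proof.
move=> /andP[t0 t1] x1 j; rewrite mxE normrM ger0_norm//.
by apply: le_lt_trans (x1 j); rewrite ler_piMl.
Qed.

Let zero_lt1 (j : 'I_2) : `|(0 : 'rV[R]_2) 0 j| < 1.
Proof. by rewrite mxE normr0. Qed.

(** The restriction of [f] to the segment from [p] is convex and critical at [p]. *)
Lemma box_real_gt (x : 'rV[R]_2) : x != 0 -> (forall j, `|x 0 j| < 1) ->
  f p < f (box_pt e x 0).
Proof.
move=> x0 x1; set v := (e *: x) *m Bx.
have ptE t : p + t *: v = box_pt e (t *: x) 0.
  by rewrite /box_pt scaler0 mul0mx addr0 scalerA mulrC -scalerA -scalemxAl.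
have sad (t : R) : 0 <= t <= 1 -> saddle_at (p + t *: v).
  by move=> t01; rewrite ptE; apply: saddle => //; exact: scale_lt1.
have := @convex_critical_lt R (fun t => f (p + t *: v)) (fun t => 'D_v f (p + t *: v))
  (fun t => 'D_v ('D_v f) (p + t *: v)).
rewrite scale0r addr0 ptE scale1r; apply.
- by move=> t /sad [[nf _] _ _]; apply: line_derive; exact: nbhs_singleton nf.
- by move=> t /sad [[_ df] _ _]; apply: line_derive; exact: df.
- exact: crit.
- by move=> t /sad [_ pos _]; apply: pos; exact: e_neq0.
Qed.

Lemma box_imag_le (y : 'rV[R]_2) : (forall j, `|y 0 j| < 1) -> f (box_pt e 0 y) <= f p.
Proof.
move=> y1; have [->|y0] := eqVneq y 0.
  by rewrite /box_pt !scaler0 !mul0mx !addr0.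
set v := (e *: y) *m By.
have ptE t : p + t *: v = box_pt e 0 (t *: y).
  by rewrite /box_pt scaler0 mul0mx addr0 (scalerA e) mulrC -scalerA -scalemxAl.
have sad (t : R) : 0 <= t <= 1 -> saddle_at (p + t *: v).
  by move=> t01; rewrite ptE; apply: saddle => //; exact: scale_lt1.
apply: ltW; rewrite -ltrN2.
have := @convex_critical_lt R (fun t => - f (p + t *: v))
  (fun t => - 'D_v f (p + t *: v)) (fun t => - 'D_v ('D_v f) (p + t *: v)).
rewrite scale0r addr0 ptE scale1r; apply.
- move=> t /sad [[nf _] _ _]; apply: is_deriveN.
  by apply: line_derive; exact: nbhs_singleton nf.
- by move=> t /sad [[_ df] _ _]; apply: is_deriveN; apply: line_derive; exact: df.
- by rewrite crit oppr0.
- by move=> t /sad [_ _ neg]; rewrite oppr_gt0; apply: neg; exact: e_neq0.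
Qed.

(** The restriction of [f] to the segment is concave. *)
Lemma box_imag_segment (x y : 'rV[R]_2) (s m : R) : (forall j, `|x 0 j| < 1) ->
  (forall j, `|y 0 j| < 1) -> 0 <= s <= 1 ->
  m < f (box_pt e x 0) -> m < f (box_pt e x y) -> m < f (box_pt e x (s *: y)).
Proof.
move=> x1 y1 s01; have [->|y0] := eqVneq y 0; first by rewrite scaler0.
set v := (e *: y) *m By.
have ptE t : box_pt e x 0 + t *: v = box_pt e x (t *: y).
  by rewrite /box_pt scaler0 mul0mx addr0 (scalerA e) mulrC -scalerA -(scalemxAl t).
have sad (t : R) : 0 <= t <= 1 -> saddle_at (box_pt e x 0 + t *: v).
  by move=> t01; rewrite ptE; apply: saddle => //; exact: scale_lt1.
move=> m0 m1.
have d1 (t : R) : 0 <= t <= 1 -> is_derive t (1 : R) (fun t => f (box_pt e x 0 + t *: v))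
    ('D_v f (box_pt e x 0 + t *: v)).
  by move=> /sad [[nf _] _ _]; apply: line_derive; exact: nbhs_singleton nf.
have d2 (t : R) : 0 <= t <= 1 -> is_derive t (1 : R)
    (fun t => 'D_v f (box_pt e x 0 + t *: v)) ('D_v ('D_v f) (box_pt e x 0 + t *: v)).
  by move=> /sad [[_ df] _ _]; apply: line_derive; exact: df.
have neg (t : R) : 0 <= t <= 1 -> 'D_v ('D_v f) (box_pt e x 0 + t *: v) < 0.
  by move=> /sad [_ _ neg]; apply: neg; exact: e_neq0.
have := concave_gt d1 d2 neg s01 (m := m).
by rewrite scale0r addr0 !ptE scale1r; apply.
Qed.

End Saddle.

(** * A chart adapted to the critical point *)

Lemma continuous_of_real (R : realType) (n : nat) : continuous (@of_real R n).
Proof.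
move=> v; apply: (@continuous_row R[i] n _ (fun j (w : 'rV[R]_(n + n)) =>
  Complex (w 0 (lshift n j)) (w 0 (rshift n j)))) => j.
by apply: continuous_Complex; exact: coord_continuous.
Qed.

Lemma open_K2 (R : realType) : open (@K2 R).
Proof.
rewrite openE => z Kz.
have nj (j : 'I_2) : nbhs z
      [set w : 'rV[R[i]]_2 | `|complex.Re (w 0 j)| < 1 /\ `|complex.Im (w 0 j)| < 1].
  have lt1 (g : 'rV[R[i]]_2 -> R) : {for z, continuous g} -> `|g z| < 1 ->
      \forall w \near z, `|g w| < 1.
    move=> gc gz; apply: (gc [set r | `|r| < 1]).
    apply: open_nbhs_nbhs; split=> //.
    apply: (@open_comp _ _ (fun r : R => `|r|) [set r | r < 1]); last exact: open_lt.
    by move=> r _; exact: norm_continuous.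
  have [h1 h2] := Kz j.
  exact: filterI (lt1 _ (@continuous_ReCoord R 2 j z) h1)
    (lt1 _ (@continuous_ImCoord R 2 j z) h2).
exact: (@filter_forall _ _ (fun (j : 'I_2) (w : 'rV[R[i]]_2) => `|complex.Re (w 0 j)| < 1 /\
  `|complex.Im (w 0 j)| < 1) _ _ nj).
Qed.

Section Adapted.
Context {R : realType} {X : topologicalType}.
Local Notation C := R[i].
Variables (A : set (chart R 2 X)) (U Z : set X) (rho : X -> R) (t0 : R) (c : X).
Hypothesis hA : is_atlas A.
Hypothesis oU : open U.
Hypothesis hsmooth : smooth A U rho.
Hypothesis hpsh : strictly_plurisubharmonic A U rho.
Hypothesis hc : level_set U rho t0 c.
Hypothesis hcrit : critical_point A rho c.
Hypothesis hind : morse_index_is A rho c 2.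
Hypothesis oS : open (superlevel_set U rho t0).
Hypothesis oZ : open Z.
Hypothesis Zc : Z c.

Section LocalModel.
Variables (phi0 : chart R 2 X) (Aphi0 : A phi0) (dc : cdom phi0 c).

Let f := in_chart rho phi0.
Let p := real_coord phi0 c.

Let hphi0 : is_chart phi0. Proof. by have [Ac _ _] := hA; exact: Ac. Qed.

Let of_p : of_real p = cmap phi0 c. Proof. exact: to_realK. Qed.

(** The real coordinates at which [in_chart] is governed by the hypotheses on [U]
and whose points lie in the prescribed neighborhood [Z]. *)
Definition covered_coord (q : 'rV[R]_(2 + 2)) :=
  ccodom phi0 (of_real q) /\ (U `&` Z) (cinv phi0 (of_real q)).

Lemma near_covered_coord : \forall q \near p, covered_coord q.
Proof.
have [_ oc _ ic _] := hphi0.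
have cc : ccodom phi0 (of_real p) by rewrite of_p; exists c.
apply: filterI.
  by apply: (@continuous_of_real R 2 p); exact: open_nbhs_nbhs.
have h : {for p, continuous (fun q => cinv phi0 (of_real q))}.
  apply: (@continuous_comp _ _ _ (@of_real R 2)); first exact: continuous_of_real.
  by apply: ic; exact: mem_set.
apply: h; apply: open_nbhs_nbhs; split; first exact: openI.
by rewrite of_p chart_cmapK//; split=> //; case: hc.
Qed.

Lemma covered_coord_image q : covered_coord q -> (real_coord phi0 @` (cdom phi0 `&` U)) q.
Proof.
move=> [cq [Uq Zq]]; have [dq mq] := chart_cinvK hphi0 cq.
by exists (cinv phi0 (of_real q)) => //; rewrite /real_coord mq of_realK.
Qed.

Lemma twice_diff_near : \forall q \near p, twice_diff f q.
Proof.
have [df d2f] := hsmooth 2 Aphi0.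
have := nbhs_interior near_covered_coord.
apply: filterS => q nq; split.
  by apply: filterS nq => x gx; apply: df; exact: covered_coord_image.
move=> u; have [d2 _] := d2f u; apply: d2; apply: covered_coord_image.
exact: nbhs_singleton nq.
Qed.

Lemma hessian_continuous u v : {for p, continuous ('D_u ('D_v f))}.
Proof.
have [df d2f] := hsmooth 2 Aphi0; have [_ d3f] := d2f v.
apply: (d3f u); apply: mem_set; apply: covered_coord_image.
exact: nbhs_singleton near_covered_coord.
Qed.

Lemma saddle_near : exists B : 'M[R]_(2, 2 + 2), frame B \in unitmx /\
  \forall q \near p, saddle_at f (- (B *m Jmx)) B q.
Proof.
have Uc : U c by case: hc.
have levi := hpsh Aphi0 Uc dc.
have [B [Bneg Bpos]] := negative_plane levi (hind Aphi0 dc).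
exists B; split; first exact: (frame_unit Bneg Bpos).
have tn := twice_diff_near; have tp := nbhs_singleton tn.
have nx := @definite_near R _ f (- (B *m Jmx)) p 1 tp tn
  (fun i j => @hessian_continuous (row i _) (row j _)).
have ny := @definite_near R _ f B p (- 1) tp tn
  (fun i j => @hessian_continuous (row i _) (row j _)).
have nx' : \forall q \near p, forall y : 'rV[R]_2, y != 0 ->
    0 < 1 * 'D_(y *m - (B *m Jmx)) ('D_(y *m - (B *m Jmx)) f) q.
  apply: nx => y y0; rewrite mul1r mulmxN mulmxA.
  by have := Bpos _ y0; rewrite -quadN.
have ny' : \forall q \near p, forall y : 'rV[R]_2, y != 0 ->
    0 < -1 * 'D_(y *m B) ('D_(y *m B) f) q.
  by apply: ny => y y0; rewrite mulN1r oppr_gt0; exact: Bneg.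
apply: filterS (filterI tn (filterI nx' ny')) => q [tq [xq yq]]; split.
- exact: tq.
- by move=> x x0; have := xq x x0; rewrite mul1r.
- by move=> y y0; have := yq y y0; rewrite mulN1r oppr_gt0.
Qed.

End LocalModel.

(** The coordinates of [frame], centered at [c] and scaled down by [small_box],
make the superlevel set a thickening. *)
Lemma adapted_chart : exists phi : chart R 2 X,
  let Y := cmap phi @` (cdom phi `&` superlevel_set U rho t0) in
  [/\ is_biholomorphism A phi, cdom phi c, cdom phi `<=` U `&` Z,
      ccodom phi = K2 & thickening Y /\ Y `<=` D2].
Proof.
have [Ac _ /(_ c)[phi0 Aphi0 dc]] := hA.
have hphi0 := Ac _ Aphi0.
have [B [Bu nsad]] := saddle_near Aphi0 dc.
pose p := real_coord phi0 c; pose f := in_chart rho phi0.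
have [e e0 he] := small_box (- (B *m Jmx)) B
  (filterI nsad (near_covered_coord Aphi0 dc)).
pose Q := box_pt p (- (B *m Jmx)) B e.
pose T : 'M[C]_2 := (e%:C)%C *: frame B.
have Tu : T \in unitmx.
  by rewrite unitmxZ// unitfE (inj_eq (@complexI R) e 0) gt_eqF.
have of_p : of_real p = cmap phi0 c by exact: to_realK.
have QT z : cmap phi0 c + z *m T = of_real (Q (rowRe z) (rowIm z)).
  rewrite /Q /box_pt /T -scalemxAr frameE -of_realZ -of_p -of_realD; congr of_real.
  rewrite -addrA; congr (_ + _).
  by rewrite scalerBr addrC mulmxN -!scalemxAl mulmxA.
have Kb (z : 'rV[C]_2) : K2 z -> (forall j, `|rowRe z 0 j| < 1) /\ (forall j, `|rowIm z 0 j| < 1).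
  by move=> Kz; split=> j; rewrite mxE; case: (Kz j).
have gQ z : K2 z -> covered_coord phi0 (Q (rowRe z) (rowIm z)).
  by move=> /Kb [h1 h2]; have [_ ?] := he _ _ h1 h2.
have Kcod z : K2 z -> ccodom phi0 (cmap phi0 c + z *m T).
  by move=> /gQ [cz _]; rewrite QT.
pose phi := affine_chart phi0 T (cmap phi0 c) K2.
have bih : is_biholomorphism A phi.
  by apply: affine_chart_biholomorphism => //; exact: open_K2.
have codomE : ccodom phi = K2 by exact: (affine_chart_codom hA).
have hphi : is_chart phi by case: bih.
have invE z : cinv phi z = cinv phi0 (of_real (Q (rowRe z) (rowIm z))).
  by rewrite /= QT.
have sad (x y : 'rV[R]_2) : (forall j, `|x 0 j| < 1) -> (forall j, `|y 0 j| < 1) ->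
    saddle_at f (- (B *m Jmx)) B (box_pt p (- (B *m Jmx)) B e x y).
  by move=> hx hy; have [] := he _ _ hx hy.
have crit u : 'D_u f p = 0 by exact: hcrit.
have fp : f p = t0.
  by rewrite /f /in_chart /= of_p chart_cmapK//; case: hc.
have real_gt (x : 'rV[R]_2) : x != 0 -> (forall j, `|x 0 j| < 1) -> t0 < f (Q x 0).
  by move=> x0 x1; rewrite -fp; exact: (box_real_gt e0 sad crit).
have imag_le (y : 'rV[R]_2) : (forall j, `|y 0 j| < 1) -> f (Q 0 y) <= t0.
  by move=> y1; rewrite -fp; exact: (box_imag_le e0 sad crit).
have segm := box_imag_segment e0 sad.
pose Y := cmap phi @` (cdom phi `&` superlevel_set U rho t0).
have YP z : Y z <-> K2 z /\ t0 < f (Q (rowRe z) (rowIm z)).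
  split=> [[x [dx [Ux rx]] <-]|[Kz fz]].
    have Kx : K2 (cmap phi x) by rewrite -codomE; exists x.
    by split=> //; rewrite /f /in_chart /= -QT -[cinv phi0 _]/(cinv phi _) chart_cmapK.
  have [dz mz] : cdom phi (cinv phi z) /\ cmap phi (cinv phi z) = z.
    by apply: chart_cinvK => //; rewrite codomE.
  exists (cinv phi z) => //; split=> //; split; rewrite invE//.
  by have [_ []] := @gQ z Kz.
have rowRe_mk x y : rowRe (mkpt x y) = \row_j x j :> 'rV[R]_2.
  by apply/rowP => j; rewrite !mxE.
have rowIm_mk x y : rowIm (mkpt x y) = \row_j y j :> 'rV[R]_2.
  by apply/rowP => j; rewrite !mxE.
have re0 (z : 'rV[C]_2) : Y z -> rowRe z != 0.
  move=> /YP [Kz]; apply: contraTneq => ->; rewrite -leNgt; apply: imag_le.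
  by case: (@Kb z Kz).
exists phi; split; [exact: bih| | |exact: codomE|split].
- split=> //; rewrite subrr mul0mx => j; rewrite mxE /=.
  by rewrite normr0 ltr01.
- move=> x dx; have Kx : K2 (cmap phi x) by rewrite -codomE; exists x.
  by have [_] := gQ _ Kx; rewrite -invE chart_cmapK.
- split.
  + rewrite openE => z Yz; have [Kz _] := (YP z).1 Yz.
    have cz : ccodom phi z by rewrite codomE.
    have [_ _ _ ic _] := hphi.
    have Sz : superlevel_set U rho t0 (cinv phi z).
      by have [x [dx Sx] <-] := Yz; rewrite chart_cmapK.
    have nS : \forall w \near z, superlevel_set U rho t0 (cinv phi w).
      by apply: (ic _ (mem_set cz) (superlevel_set U rho t0)); exact: open_nbhs_nbhs.
    have nK : \forall w \near z, K2 w.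
      by apply: open_nbhs_nbhs; split=> //; exact: open_K2.
    apply: filterS2 nK nS => w Kw Sw; have cw : ccodom phi w by rewrite codomE.
    by have [dw mw] := chart_cinvK hphi cw; exists (cinv phi w).
  + by move=> z /YP[].
  + move=> x x1 xn0; apply/YP; split.
      by move=> j; rewrite !mxE /= normr0.
    rewrite rowRe_mk rowIm_mk (_ : \row_j 0 = 0); last by apply/rowP => j; rewrite !mxE.
    apply: real_gt; last by move=> j; rewrite mxE.
    apply: contra_notN xn0 => /eqP x0; apply/funext => j.
    by have := congr1 (fun v : 'rV[R]_2 => v 0 j) x0; rewrite !mxE.
  + move=> z t Yz t01; have [Kz fz] := (YP z).1 Yz; have [h1 h2] := @Kb z Kz.
    have [t0' t1] := andP t01.
    apply/YP; split.
      move=> j; have [r1 i1] := Kz j; rewrite !mxE /=; split=> //.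
      by rewrite normrM ger0_norm//; apply: le_lt_trans i1; rewrite ler_piMl.
    rewrite rowRe_mk rowIm_mk.
    have -> : \row_j Rept z j = rowRe z by [].
    have -> : (\row_j (t * Impt z j)) = t *: rowIm z.
      by apply/rowP => j; rewrite !mxE.
    by apply: segm => //; apply: real_gt => //; exact: re0.
- move=> z Yz; have [Kz _] := (YP z).1 Yz; split=> // z0.
  have /eqP := @re0 z Yz; apply; apply/rowP => j; rewrite !mxE; exact: z0.
Qed.

End Adapted.

(** * Gluing a bundle that is trivial near the critical point *)

Section Assembly.
Context {R : realType} {X : topologicalType}.
Local Notation C := R[i].
Local Notation C2 := 'rV[R[i]]_2.
Local Notation std := (std_atlas R 2).

Lemma bundle_iso_refl (n : nat) (T : topologicalType) (A : set (chart R n T))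
    (W : set T) (L : cech1 T C) : line_bundle A W L -> bundle_iso A L L.
Proof.
move=> [_ _ Lu Lc]; exists (fun i p x => cval L p i x); split.
  by move=> i p; rewrite setIC; exact: Lu.
by move=> i j p q x ix jx px qx; rewrite !Lc.
Qed.

Lemma F_bundle_line_bundle (k : nat) (l : nat) (a : cech1 C2 int) :
  Z_cocycle D2 a -> line_bundle std D2 (F_bundle k l a).
Proof.
move=> [ao aD al ac]; split=> //.
- move=> p q; split; last by move=> z _; exact: cexp_neq0.
  apply/std_holomorphicP => z pqz.
  have h := al p q z pqz.
  apply: (@near_eq_differentiable _ _ _
    (cst (cexp (Complex 0 (2 * pi) * (l%:R / k%:R * (cval a p q z)%:~R))) : C2 -> C^o)).
    by apply: filterS h => w /= ->.
  exact: differentiable_cst.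
- move=> p q r z pz qz rz /=.
  by rewrite -cexpD -!mulrDr -intrD ac.
Qed.

Variables (A : set (chart R 2 X)).
Hypothesis hA : is_atlas A.
Variables (S : set X) (F : cech1 X C).
Hypothesis hF : line_bundle A S F.
Variable phi : chart R 2 X.
Hypothesis bih : is_biholomorphism A phi.

Let Y : set C2 := cmap phi @` (cdom phi `&` S).
Let L : cech1 C2 C := cech_pullback (cinv phi) Y F.
Let hphi : is_chart phi. Proof. by case: bih. Qed.

Let Fopen i : open (ccover F i). Proof. by case: hF. Qed.
Let FS i x : ccover F i x -> S x.
Proof. by case: hF => _ <- _ _; exists i. Qed.

Lemma pullback_point z : Y z -> exists x, [/\ cdom phi x, S x, cmap phi x = z & cinv phi z = x].
Proof. by move=> [x [dx Sx] <-]; exists x; rewrite chart_cmapK. Qed.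

Lemma pullback_holomorphic (W : set X) (f : X -> C) z :
  holomorphic A W f -> Y z -> W (cinv phi z) ->
  differentiable (f \o cinv phi : C2 -> C^o) z.
Proof.
move=> hf Yz; have [x [dx Sx <- ->]] := pullback_point Yz => Wx.
exact: (holomorphic_pullback hA bih hf).
Qed.

Lemma pullback_line_bundle : open Y -> line_bundle std Y L.
Proof.
move=> oY; have [_ Fcov Fu Fc] := hF; have [_ _ _ ic _] := hphi.
split.
- move=> i; rewrite openE => z [Yz iz].
  have [x [dx Sx mx _]] := pullback_point Yz.
  have cz : ccodom phi z by exists x.
  apply: filterI; first exact: open_nbhs_nbhs.
  by apply: (ic _ (mem_set cz)); exact: open_nbhs_nbhs.
- apply/seteqP; split=> [z [i _ []//]|z Yz].
  have [x [dx Sx mx xz]] := pullback_point Yz.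
  by move: Sx; rewrite -Fcov => -[i _ ix]; exists i => //; split=> //=; rewrite xz.
- move=> i j; have [hol nz] := Fu i j; split; last first.
    by move=> z [[_ iz] [_ jz]]; exact: nz.
  apply/std_holomorphicP => z [[Yz iz] [_ jz]].
  exact: (pullback_holomorphic hol).
- by move=> i j p z [_ iz] [_ jz] [_ pz]; exact: Fc.
Qed.

Variable u : cix L -> C2 -> C.
Hypothesis uu : forall i, holomorphic_unit std (ccover L i) (u i).
Hypothesis uc : forall i j z, ccover L i z -> ccover L j z ->
  u i z = cval L i j z * u j z.

Let ccover_L i x : ccover F i x -> cdom phi x -> ccover L i (cmap phi x).
Proof.
move=> ix dx; split; last by rewrite /= chart_cmapK.
by exists x => //; split=> //; exact: FS ix.
Qed.

Let v i x := u i (cmap phi x).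

Let v_neq0 i x : ccover F i x -> cdom phi x -> v i x != 0.
Proof. by move=> ix dx; have [_] := uu i; apply; exact: ccover_L. Qed.

Let vc i j x : ccover F i x -> ccover F j x -> cdom phi x ->
  v i x = cval F i j x * v j x.
Proof.
move=> ix jx dx; rewrite /v (@uc i j); [|exact: ccover_L..].
by rewrite /= chart_cmapK.
Qed.

Let v_hol i (W : set X) : W `<=` ccover F i -> W `<=` cdom phi ->
  holomorphic_unit A W (v i) /\ holomorphic_unit A W (fun x => (v i x)^-1).
Proof.
move=> Wi Wd.
have ud x : W x -> differentiable (u i : C2 -> C^o) (cmap phi x).
  move=> Wx; have [/std_holomorphicP + _] := uu i; apply.
  by apply: ccover_L; [exact: Wi|exact: Wd].
have vn x : W x -> v i x != 0.
  by move=> Wx; apply: v_neq0; [exact: Wi|exact: Wd].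
split; split; [|exact: vn| |].
- exact: (holomorphic_pushforward hA bih Wd ud).
- apply: (@holomorphic_pushforward _ _ _ _ hA _ _ (fun z => (u i z)^-1) bih Wd).
  by move=> x Wx; apply: differentiableV; [exact: ud | exact: vn].
- by move=> x Wx; rewrite invr_neq0 ?vn.
Qed.

Lemma holomorphic_cst1 (W : set X) : holomorphic_unit A W (fun=> 1).
Proof.
split; last by move=> x _; exact: oner_neq0.
move=> psi x _ _ _.
exact: (@differentiable_cst C _ C^o 1 (cmap psi x)).
Qed.

(** The trivial bundle on the chart domain is glued to [F] by means of the
nowhere vanishing section [v]. *)
Definition extended_bundle : cech1 X C :=
  Cech1 (fun o : option (cix F) => if o is Some i then ccover F i else cdom phi)
    (fun o o' x => match o, o' with
      | Some i, Some j => cval F i j x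
      | Some i, None => v i x
      | None, Some j => (v j x)^-1
      | None, None => 1
      end).

Lemma extended_line_bundle : line_bundle A (S `|` cdom phi) extended_bundle.
Proof.
have [Fo Fcov Fu Fc] := hF; have [od _ _ _ _] := hphi.
split.
- by case=> [i|] /=; [exact: Fo|].
- apply/seteqP; split=> [x [[i|] _ /=]|x].
  + by move=> ix; left; exact: FS ix.
  + by right.
  + move=> [|dx]; last by exists None.
    by rewrite -Fcov => -[i _ ix]; exists (Some i).
- case=> [i|] [j|] /=.
  + exact: Fu.
  + by have [] := @v_hol i (ccover F i `&` cdom phi) (@subIsetl _ _ _) (@subIsetr _ _ _).
  + by have [] := @v_hol j (cdom phi `&` ccover F j) (@subIsetr _ _ _) (@subIsetl _ _ _).
  + exact: holomorphic_cst1.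
case=> [i|] [j|] [p|] x /= ix jx px; rewrite ?mul1r ?mulr1 //.
- exact: Fc.
- by rewrite -vc.
- by rewrite (vc ix px jx) mulfK ?v_neq0.
- rewrite (vc jx px ix); have vp := v_neq0 px ix.
  have [_ /(_ x (conj jx px)) gn] := Fu j p.
  by rewrite invfM mulrAC mulVf ?mul1r.
- by rewrite mulVf ?v_neq0.
Qed.

Lemma extended_bundle_iso : bundle_iso A (cech_restrict S extended_bundle) F.
Proof.
have [Fo Fcov Fu Fc] := hF.
exists (fun o p x => if o is Some i then cval F p i x else v p x); split.
  case=> [i|] p.
    have [hol nz] := Fu p i; split.
      by move=> psi x Apsi [[_ ix] px] dx; exact: hol.
    by move=> x [[_ ix] px]; exact: nz.
  have [] := @v_hol p ((S `&` cdom phi) `&` ccover F p) (@subIsetr _ _ _) => //.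
  by move=> x [[]].
case=> [i|] [j|] p q x [Sx ix] [_ jx] px qx; rewrite /= ?mulr1.
- by rewrite !Fc.
- by rewrite -!vc.
- by rewrite (vc px jx ix) mulfK ?v_neq0// Fc.
- exact: vc.
Qed.

Lemma trivial_extends c : cdom phi c -> extends_near A S c F.
Proof.
move=> dc; exists (cdom phi), extended_bundle; split=> //; first by case: hphi.
split; [by left | exact: extended_line_bundle | exact: extended_bundle_iso].
Qed.

End Assembly.

(** * The theorem *)

Unset Implicit Arguments.
Set Strict Implicit.

Theorem theorem2 (R : realType)
  (a : cech1 'rV[R[i]]_2 int) (ha : is_generator a)
  (X : topologicalType) (A : set (chart R 2 X)) (hX : complex_manifold A)
  (U : set X) (hU : domain U)
  (rho : X -> R) (hsmooth : smooth A U rho)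
  (hpsh : strictly_plurisubharmonic A U rho) (hmorse : morse A U rho)
  (t0 : R) (c : X)
  (hSconn : connected (level_set U rho t0))
  (hScomp : compact (level_set U rho t0))
  (hcS : (level_set U rho t0) c)
  (hccrit : critical_point A rho c)
  (hcuniq : forall x, (level_set U rho t0) x ->
    critical_point A rho x -> x = c)
  (hcind : morse_index_is A rho c 2)
  (N : cech1 X R[i]) (hN : line_bundle A U N)
  (k : nat) (hk : (2 <= k)%N)
  (F : cech1 X R[i]) (hF : is_root A k N (superlevel_set U rho t0) F)
  (hext : ~ extends_near A (superlevel_set U rho t0) c F) :
  exists phi : chart R 2 X,
    [/\ is_biholomorphism A phi, cdom phi c, cdom phi `<=` U,
        ccodom phi = K2 &
        let Y := cmap phi @` (cdom phi `&` (superlevel_set U rho t0)) in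
        exists (E : cech1 'rV[R[i]]_2 R[i]) (l : nat),
          [/\ (1 <= l < k)%N,
              is_extension (std_atlas R 2) Y D2 (cech_pullback (cinv phi) Y F) E &
              bundle_iso (std_atlas R 2) E (F_bundle k l a)]].
Proof.
have [_ _ hA] := hX; have [oU _ _] := hU.
have [bF [h [hu hg]]] := hF.
have oS : open (superlevel_set U rho t0).
  by have [Fo <- _ _] := bF; apply: bigcup_open => i _; exact: Fo.
have [Uc _] := hcS.
have [No Ncov _ _] := hN.
have [p0 _ p0c] : (\bigcup_i ccover N i) c by rewrite Ncov.
have [phi [bih dc dU codomE [Yth YD]]] :=
  adapted_chart hA oU hsmooth hpsh hcS hccrit hcind oS (No p0) p0c.
exists phi; split=> //; first by move=> x /dU [].
move=> Y.
pose L := cech_pullback (cinv phi) Y F.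
have hL : line_bundle (std_atlas R 2) Y L.
  by apply: (pullback_line_bundle hA bF bih); exact: (thick_open Yth).
have p0z z : Y z -> ccover N p0 (cinv phi z).
  by move=> [x [dx _] <-]; rewrite chart_cmapK//; [have [] := dU _ dx | case: bih].
have Sz z : Y z -> superlevel_set U rho t0 (cinv phi z).
  by move=> [x [dx ?] <-]; rewrite chart_cmapK//; case: bih.
have [||l hl] := @torsion_bundle_iso R k hk Y Yth YD a ha L
  (fun i z => h i p0 (cinv phi z)) hL.
- move=> i; have [hol nz] := hu i p0; split.
    apply/std_holomorphicP => z [Yz iz].
    apply: (pullback_holomorphic hA bih hol Yz).
    by split=> //; split; [exact: Sz | exact: p0z].
  by move=> z [Yz iz]; apply: nz; split=> //; split; [exact: Sz | exact: p0z].
- move=> i j z [Yz iz] [_ jz].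
  have hp : ccover (cech_restrict (superlevel_set U rho t0) N) p0 (cinv phi z).
    by split; [exact: Sz | exact: p0z].
  have := hg i j p0 p0 (cinv phi z) iz jz hp hp.
  have -> : cval (cech_restrict (superlevel_set U rho t0) N) p0 p0 (cinv phi z) = 1.
    by apply: (line_bundle_diag hN); exact: p0z.
  by rewrite mul1r.
have [aZ _] := ha.
exists (F_bundle k l a), (nat_of_ord l); split.
- apply/andP; split; last by rewrite -[ltnRHS](Zp_cast hk).
  rewrite lt0n; apply/negP => /eqP l0; apply: hext.
  rewrite l0 in hl.
  have [u [uu uc]] := trivial_bundle_section YD ha hL hl.
  exact: (trivial_extends hA bF bih uu uc).
- by split=> //; exact: F_bundle_line_bundle.
- exact: (bundle_iso_refl (F_bundle_line_bundle k l aZ)).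
Qed.
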